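(* Let $p>0$ and $q$ be relatively prime odd integers with $-p<q<p$, let $K\subset S^3$ be the two-bridge knot with Schubert normal form $(p,q)$, and let $M$ be its exterior, with $$\pi_1(M)=\langle g_1,g_2\mid w g_1 w^{-1} g_2^{-1}\rangle,\qquad w=g_1^{\epsilon_1}g_2^{\epsilon_2}\cdots g_1^{\epsilon_{p-2}}g_2^{\epsilon_{p-1}},\qquad \epsilon_i=(-1)^{\lfloor iq/p\rfloor}.$$ Let $\mu=g_1$ (a meridian of $K$). Let $\rho:\pi_1(M)\to \mathrm{SL}_2(\mathbb{C})$ be an irreducible representation given by $$\rho(g_1)=\begin{pmatrix} m&1\\0&m^{-1}\end{pmatrix},\qquad \rho(g_2)=\begin{pmatrix} m&0\\-u&m^{-1}\end{pmatrix}$$ with $m\neq0$, $u\neq0$ and $\phi_w(m,u)=0$, and let $\chi_\rho$ be its character. Suppose that $\chi_\rho$ is $\mu$-regular and that $m\neq\pm1$, $\frac{\partial\phi_w}{\partial m}\neq0$ and $\frac{\partial\phi_w}{\partial u}\neq0$ at $(m,u)$. Then $$\mathbb{T}_\mu(\chi_\rho)=\pm\,\frac{m^{\epsilon_k+1}}{2(m^2-1)}\,\frac{w_{11}}{v_{11}\,\phi_v}\,\frac{\partial\phi_w}{\partial u},$$ where the right-hand side is evaluated at $(m,u)$, $0<k<p$ is the unique (odd) integer satisfying $kq\equiv\pm1\pmod{2p}$, and $v=g_1^{\epsilon_1}g_2^{\epsilon_2}\cdots g_1^{\epsilon_{k-2}}g_2^{\epsilon_{k-1}}$ (the empty word if $k=1$).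 The sign $\pm$ does not depend on the choice of $\chi_\rho$ (for a given knot presentation).
   Context: **Notation for words.** For a word $g$ in $g_1^{\pm1},g_2^{\pm1}$, let $g_{ij}\in\mathbb{Z}[m^{\pm1},u]$ be the $(i,j)$-entry of the matrix obtained by substituting the matrices $\begin{pmatrix} m&1\\0&m^{-1}\end{pmatrix}$ and $\begin{pmatrix} m&0\\-u&m^{-1}\end{pmatrix}$ (with $m,u$ regarded as variables) for $g_1$ and $g_2$ respectively, and put $\phi_g:=g_{11}-(m-m^{-1})g_{12}$. The polynomial $\phi_w$ is the Riley polynomial of $K$. Up to conjugation every irreducible $\mathrm{SL}_2(\mathbb{C})$-representation $\rho$ of $\pi_1(M)$ has the form $\rho(g_1)=\begin{pmatrix} m&1\\0&m^{-1}\end{pmatrix}$, $\rho(g_2)=\begin{pmatrix} m&0\\-u&m^{-1}\end{pmatrix}$ with $m\ne0$, $u\neq 0$, $\phi_w(m,u)=0$. $\lfloor x\rfloor$ is the greatest integer $\le x$. **Twisted cochains.** Let $\mathfrak{g}=\mathfrak{sl}_2(\mathbb{C})$ with basis $e_1=\begin{pmatrix}0&1\\0&0\end{pmatrix}$, $e_2=\begin{pmatrix}1&0\\0&-1\end{pmatrix}$, $e_3=\begin{pmatrix}0&0\\1&0\end{pmatrix}$ and Killing form $$\left\langle\begin{pmatrix} b&a\\c&-b\end{pmatrix},\begin{pmatrix} b'&a'\\c'&-b'\end{pmatrix}\right\rangle_{\mathfrak{g}}=8bb'+4(ac'+ca').$$ Fix a triangulation of $M$, orient its cells, and let $\widetilde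 M$ be the universal cover. Set $C^*(M;\mathfrak{g}_\rho)=\mathrm{Hom}_{\mathbb{Z}[\pi_1M]}(C_*(\widetilde M;\mathbb{Z}),\mathfrak{g})$, where $\pi_1(M)$ acts on $\mathfrak{g}$ by $\mathrm{Ad}\circ\rho$; let $\delta^i$ be its coboundary maps and $H^*(M;\mathfrak{g}_\rho)$ its cohomology. Choosing a lift $\widetilde c_j$ of each cell $c_j$, let $\mathbf{c}^*$ be the basis $(c_1^1,c_1^2,c_1^3,c_2^1,\dots)$, where $c_j^i$ sends $\widetilde c_j$ to $e_i$ and the other chosen lifts to $0$; $\mathbf{c}^i$ denotes the part in degree $i$. **Regularity.** An irreducible $\rho$ (equivalently $\chi_\rho$) is $\mu$-regular if the restriction map $H^1(M;\mathfrak{g}_\rho)\to H^1(\mu;\mathfrak{g}_\rho)$ is injective (equivalently, the map $H_1(\mu;\mathfrak{g}_\rho)\to H_1(M;\mathfrak{g}_\rho)$ is surjective) and, in case $\mathrm{tr}\,\rho(\pi_1(\partial M))\subset\{\pm2\}$, $\rho(\mu)\ne\pm I$. Then $\dim H^i(M;\mathfrak{g}_\rho)=1$ for $i=1,2$ and $0$ otherwise. **Cohomology bases.** Let $\rho$ be $\mu$-regular and let $P\in\mathfrak{g}$ be nonzero and invariant under $\mathrm{Ad}_{\rho(g)}$ for all $g\in\pi_1(\partial M)$. With orientations of $\mu$ and $\partial M$ fixed once and for all, let $\widetilde\mu\in C_1(\widetilde M;\mathbb{Z})$ and $\widetilde{\partial M}\in C_2(\widetilde M;\mathbb{Z})$ be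 chains that are lifts of $\mu$ and of (the sum of the oriented 2-cells of) $\partial M$ with the same base point, lying in the component of the preimage of $\partial M$ stabilized by $\pi_1(\partial M)$. Then $F_1(x)=\langle P,x(\widetilde\mu)\rangle_{\mathfrak g}$ and $F_2(x)=\langle P,x(\widetilde{\partial M})\rangle_{\mathfrak g}$ define isomorphisms $F_i:H^i(M;\mathfrak{g}_\rho)\to\mathbb{C}$, and $\mathbf{h}^i$ is the basis of $H^i(M;\mathfrak{g}_\rho)$ with $F_i(\mathbf{h}^i)=1$, $i=1,2$. **Adjoint torsion.** For each $i$ choose a sequence $b^i$ in $C^i(M;\mathfrak g_\rho)$ such that $\delta^i(b^i)$ is a basis of $\mathrm{Im}\,\delta^i$ and a representative $\widetilde{\mathbf h}^i$ of $\mathbf{h}^i$, and put $$\mathrm{tor}(C^*(M;\mathfrak g_\rho),\mathbf c^*,\mathbf h^* )=\prod_i\big[(\delta^{i-1}(b^{i-1}),\widetilde{\mathbf h}^i,b^i)/\mathbf c^i\big]^{(-1)^i},$$ where $[x/y]$ is the determinant of the transition matrix sending the basis $y$ to the basis $x$. The adjoint Reidemeister torsion is $\mathbb{T}_\mu(\rho)=\epsilon\cdot\mathrm{tor}(C^*(M;\mathfrak g_\rho),\mathbf c^*,\mathbf h^* )\in\mathbb{C}^*$, where $\epsilon\in\{\pm1\}$ is given by Turaev's sign trick: fixing a homology orientation of $M$ (an orientation of $H^*(M;\mathbb{R})$), $\epsilon=(-1)^{|C^*(M;\mathfrak g_\rho)|}\,\mathrm{sgn}\big((-1)^{|C^*(M;\mathbb{R})|}\mathrm{tor}(C^*(M;\mathbb{R}),c^*,h^*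 )\big)$, with $c^*$ the basis dual to the oriented cells in the same order, $h^*$ a positively oriented basis of $H^*(M;\mathbb{R})$, and $|C^*|=\sum_j\big(\sum_{i\le j}\dim C^i\big)\big(\sum_{i\le j}\dim H^i\big)$. Thus $\epsilon$ does not depend on the choice of $\mu$-regular $\rho$. $\mathbb{T}_\mu(\rho)$ depends only on the conjugacy class of $\rho$, equivalently on $\chi_\rho$, and is written $\mathbb{T}_\mu(\chi_\rho)$. It may be computed with the 2-complex of the presentation in place of $M$. *)

(* Defs.v *)
From HB Require Import structures.
From mathcomp Require Import all_boot all_order all_algebra complex.
From mathcomp Require Import all_classical reals topology normedtype derive.

Set Implicit Arguments.
Unset Strict Implicit.
Unset Printing Implicit Defensive.

Import Order.TTheory GRing.Theory Num.Theory.
Import numFieldNormedType.Exports.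

Local Open Scope ring_scope.

(* Words in g_1^{+-1}, g_2^{+-1}: the letter (j, b) is g_(j+1) if b holds and
   g_(j+1)^{-1} otherwise. *)
Definition letter : Type := ('I_2 * bool)%type.
Definition word : Type := seq letter.

Definition g1 : letter := (0, true).
Definition g2 : letter := (1, true).

Definition linv (l : letter) : letter := (l.1, ~~ l.2).
Definition winv (g : word) : word := rev (map linv g).

Definition lpow (l : letter) (n : int) : word :=
  match n with Posz k => nseq k l | Negz k => nseq k.+1 (linv l) end.

Definition reduce : word -> word :=
  foldr (fun l s => if s is l' :: s' then
                      if l' == linv l then s' else l :: s
                    else [:: l]) [::].

Definition free_eq (g h : word) : bool := reduce g == reduce h.

Definition wcomm (g h : word) : word := g ++ h ++ winv g ++ winv h.

Section TwoBridge.
Variables (p : nat) (q : int).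

(* For p > 0, %/ on int is the floor of the quotient. *)
Definition eps (i : nat) : int := (-1) ^ ((i%:Z * q) %/ p%:Z)%Z.

(* The prefix of length n of g_1^{eps_1} g_2^{eps_2} g_1^{eps_3} ... *)
Definition tb_prefix (n : nat) : word :=
  [seq ((if odd i then 0 else 1) : 'I_2, eps i == 1) | i <- iota 1 n].

Definition tb_word : word := tb_prefix p.-1.

Definition relator : word := tb_word ++ [:: g1] ++ winv tb_word ++ [:: linv g2].

Definition mu : word := [:: g1].

(* The preferred longitude commuting with mu = g_1.  Since eps_i = eps_(p-i),
   rev tb_word is tb_word with g_1 and g_2 exchanged. *)
Definition lambda : word :=
  rev tb_word ++ tb_word ++ lpow g1 (- (2 * \sum_(1 <= i < p) eps i)).

Inductive peripheral : word -> Prop :=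
| peripheral_nil : peripheral [::]
| peripheral_mu : peripheral mu
| peripheral_lambda : peripheral lambda
| peripheral_inv g : peripheral g -> peripheral (winv g)
| peripheral_cat g h : peripheral g -> peripheral h -> peripheral (g ++ h).

(* The boundary torus in the 2-complex of the presentation: the square with
   boundary [lambda, mu] is filled by two copies of the 2-cell r, one for each
   of the annuli into which the torus is cut by the meridians g_1 and g_2.  As
   [lambda, mu] = (rev w) r (rev w)^{-1} . (rev w) g_2 (rev w)^{-1} g_1^{-1},
   the word h is such that the last factor, the relator with g_1 and g_2
   exchanged, is h r^{-1} h^{-1} in the free group.  The lift of the torus is
   then the 2-chain (rev w) r~ - h r~; since the 2-complex is aspherical, this
   is the only 2-chain with the same boundary as the lifted square. *)
Definition torus_filling (h : word) : bool :=
  free_eq (wcomm lambda mu)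
          (rev tb_word ++ relator ++ winv (rev tb_word) ++
           h ++ winv relator ++ winv h).

Definition torus_chain (h : word) : seq (int * word) :=
  [:: (1, rev tb_word); (-1, h)].

End TwoBridge.

(* A sequence of cochains in each degree; a cochain is the matrix whose rows
   are the coordinates of its values on the chosen lifts of the cells. *)
Record graded_seq (F : fieldType) (d : nat) := GradedSeq {
  deg0 : seq 'M[F]_(1, d);
  deg1 : seq 'M[F]_(2, d);
  deg2 : seq 'M[F]_(1, d) }.

(* Equivariant cochains of the universal cover of the presentation 2-complex
   of < g_1, g_2 | r > (one 0-cell, two 1-cells, one 2-cell), with values in
   F^d on which the letter l acts by act l.  All chosen lifts start at the same
   lift of the 0-cell. *)
Section Cochains.
Variables (F : fieldType) (d : nat) (act : letter -> 'rV[F]_d -> 'rV[F]_d).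
Variable r : word.

Definition wact (g : word) (x : 'rV[F]_d) : 'rV[F]_d := foldr act x g.

(* The value of the 1-cochain x on the lift of the path g; a letter g_j^{-1}
   contributes - g_j^{-1} x(g_j~) (Fox calculus). *)
Fixpoint on_path (x : 'M[F]_(2, d)) (g : word) : 'rV[F]_d :=
  if g is l :: g' then
    if l.2 then row l.1 x + act l (on_path x g')
    else act l (on_path x g' - row l.1 x)
  else 0.

Definition on_chain2 (y : 'M[F]_(1, d)) (c : seq (int * word)) : 'rV[F]_d :=
  \sum_(a <- c) wact a.2 y *~ a.1.

Definition delta0 : 'Hom('M[F]_(1, d), 'M[F]_(2, d)) :=
  linfun (fun x : 'M[F]_(1, d) =>
            \matrix_(j < 2) (act (j, true) x - x) : 'M[F]_(2, d)).

Definition delta1 : 'Hom('M[F]_(2, d), 'M[F]_(1, d)) :=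
  linfun (fun x : 'M[F]_(2, d) => on_path x r : 'M[F]_(1, d)).

(* The vectors hs of Z represent a basis of Z / B, for B contained in Z. *)
Definition quotient_basis (V : vectType F) (Z B : {vspace V}) (hs : seq V) : bool :=
  ((B + <<hs>>)%VS == Z) && (\dim Z == \dim B + size hs)%N.

Definition cohomology_basis (h : graded_seq F d) : bool :=
  [&& quotient_basis (lker delta0) 0%VS (deg0 h),
      quotient_basis (lker delta1) (limg delta0) (deg1 h)
    & quotient_basis fullv (limg delta1) (deg2 h)].

Definition coboundary_lift (b : graded_seq F d) : bool :=
  [&& basis_of (limg delta0) (map delta0 (deg0 b)),
      basis_of (limg delta1) (map delta1 (deg1 b))
    & nilp (deg2 b)].

(* [xs / c] for the basis c of 'M_(n, d) ordered cell by cell. *)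
Definition basis_det (n : nat) (xs : seq 'M[F]_(n, d)) : F :=
  \det (\matrix_(i < n * d) mxvec (nth 0 xs i)).

Definition torsion (b h : graded_seq F d) : F :=
  basis_det (deg0 h ++ deg0 b)
  * (basis_det (map delta0 (deg0 b) ++ deg1 h ++ deg1 b))^-1
  * basis_det (map delta1 (deg1 b) ++ deg2 h ++ deg2 b).

Definition betti0 : nat := \dim (lker delta0).
Definition betti1 : nat := (\dim (lker delta1) - \dim (limg delta0))%N.
Definition betti2 : nat := (d - \dim (limg delta1))%N.

(* The integer |C^*| of Turaev's sign. *)
Definition turaev_exponent : nat :=
  (d * betti0
   + (d + 2 * d) * (betti0 + betti1)
   + (d + 2 * d + d) * (betti0 + betti1 + betti2))%N.

End Cochains.

Definition trivial_act (F : fieldType) (l : letter) (x : 'rV[F]_1) : 'rV[F]_1 := x.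

Section SL2.
Variable K : fieldType.
Implicit Types (rho : 'I_2 -> 'M[K]_2) (m u : K).

Definition mx22 (a b c d : K) : 'M[K]_2 :=
  \matrix_(i, j) (if i == 0 then if j == 0 then a else b
                  else if j == 0 then c else d).

Definition riley m u (j : 'I_2) : 'M[K]_2 :=
  if j == 0 then mx22 m 1 0 m^-1 else mx22 m 0 (- u) m^-1.

Definition rho_letter rho (l : letter) : 'M[K]_2 :=
  if l.2 then rho l.1 else (rho l.1)^-1.

Definition rho_word rho (g : word) : 'M[K]_2 := \prod_(l <- g) rho_letter rho l.

Definition phi (g : word) m u : K :=
  let G := rho_word (riley m u) g in G 0 0 - (m - m^-1) * G 0 1.

(* Words act on column vectors, hence the transpose. *)
Definition irreducible_rep rho : Prop :=
  forall U : 'M[K]_2, (forall g : word, stablemx U (rho_word rho g)^T) ->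
    U = 0 \/ row_full U.

(* Coordinates with respect to the basis e_1, e_2, e_3 of sl_2. *)
Definition sl2_mx (x : 'rV[K]_3) : 'M[K]_2 :=
  mx22 (x 0 1) (x 0 0) (x 0 2%:R) (- x 0 1).

Definition sl2_coord (A : 'M[K]_2) : 'rV[K]_3 :=
  \row_j nth 0 [:: A 0 1; A 0 0; A 1 0] j.

Definition Ad rho (l : letter) (x : 'rV[K]_3) : 'rV[K]_3 :=
  sl2_coord (rho_letter rho l * sl2_mx x * (rho_letter rho l)^-1).

Definition killing (x y : 'rV[K]_3) : K :=
  8%:R * (x 0 1 * y 0 1) + 4%:R * (x 0 0 * y 0 2%:R + x 0 2%:R * y 0 0).

Definition mu_regular p q rho : Prop :=
  (forall x : 'M[K]_(2, 3),
      x \in lker (delta1 (Ad rho) (relator p q)) ->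
      (exists y : 'rV[K]_3, on_path (Ad rho) x mu = wact (Ad rho) mu y - y) ->
      x \in limg (delta0 (Ad rho))) /\
  ((forall g, peripheral p q g ->
      \tr (rho_word rho g) = 2%:R \/ \tr (rho_word rho g) = - 2%:R) ->
   rho_word rho mu <> 1 /\ rho_word rho mu <> -1).

End SL2.

(* Entries are Laurent polynomials in m and polynomials in u, so for m != 0
   the formal partial derivatives of phi are those of the function phi g. *)
Definition dphi_dm (K : numFieldType) (g : word) (m u : K) : K :=
  derive1 (fun z : K => phi g z u) m.

Definition dphi_du (K : numFieldType) (g : word) (m u : K) : K :=
  derive1 (fun z : K => phi g m z) u.

Section AdjointTorsion.
Variable R : realType.
Variables (p : nat) (q : int).
Local Notation C := R[i].
Local Notation r := (relator p q).

(* T is the adjoint torsion of rho computed from some choice of P, h^*, b^*.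
   The word h gives the chain lifting the boundary torus (see torus_filling),
   o its orientation, and hR is a positively oriented basis of H^*(M; R). *)
Definition is_adjoint_torsion (h : word) (o : bool) (hR : graded_seq R 1)
    (rho : 'I_2 -> 'M[C]_2) (T : C) : Prop :=
  exists (P : 'rV[C]_3) (h1 : 'M[C]_(2, 3)) (h2 : 'M[C]_(1, 3))
         (b : graded_seq C 3) (bR : graded_seq R 1),
  let act := Ad rho in
  let hC := GradedSeq [::] [:: h1] [:: h2] in
  let eR := (-1) ^+ turaev_exponent (@trivial_act R) r
            * torsion (@trivial_act R) r bR hR in
  let e := (-1) ^+ turaev_exponent act r * (real_complex R (Num.sg eR)) in
  [/\ P != 0 /\ (forall g, peripheral p q g -> wact act g P = P),
      cohomology_basis act r hC,
      killing P (on_path act h1 mu) = 1 /\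
      (-1) ^+ o * killing P (on_chain2 act h2 (torus_chain p q h)) = 1,
      coboundary_lift act r b /\ coboundary_lift (@trivial_act R) r bR
    & T = e * torsion act r b hC].

End AdjointTorsion.

(* Main.v *)
Require Import Defs.
From HB Require Import structures.
From mathcomp Require Import all_boot all_order all_algebra complex.
From mathcomp Require Import all_classical reals topology normedtype derive.
From mathcomp Require Import zify ring.

Set Implicit Arguments.
Unset Strict Implicit.
Unset Printing Implicit Defensive.

Import Order.TTheory GRing.Theory Num.Theory.
Import numFieldNormedType.Exports.

Local Open Scope ring_scope.

(** The torsion is a ratio of volumes in the three cochain groups of the
presentation complex.  Pairing the bases of these groups with functionals that
are triangular for the coboundary maps turns the volumes into determinants of
explicit functionals, and all the lifts that were chosen cancel
([torsion_functionals]).  Write A, B, W, V for the images of g_1, g_2, w, v, let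
delta^1 be the coboundary map from degree one to degree two, and put
P = c (A - A^-1), the only possible form of an invariant of the peripheral
subgroup.

Besides the functionals F_1 and F_2 that normalize the cohomology bases, two
functionals on sl_2 are used.  The first, psi_1, is the pairing with B - B^-1.
Since W carries the axis of A to the axis of B, and B fixes its own axis, Fox
calculus of w disappears from psi_1 (delta^1 x), which depends on x(g_1) and
x(g_2) alone ([killing_axis2_d1]).  The second, psi_2, is the upper right entry.
It has to be evaluated on one coboundary only, that of the cochain tangent to
the deformation of the representation in the direction of u.  There the
derivative of the defining equation W A = B W appears, and the value is a
multiple of w_11 and of the derivative of phi_w ([d1_e3_entry]).

The words v and k enter through F_2.  The boundary torus consists of two copies
of the 2-cell because exchanging the generators takes the relator r to a
conjugate h_0 r^-1 h_0^-1 of its inverse.  Read cyclically, the n-th letter of r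
has its sign given by the parity of the floor of (n q - 1) / p, so that
k q = +-1 mod 2 p makes the exchange a reversal followed by a shift by k; hence
h_0 is v^-1 or g_1 v^-1 g_2^-1 ([swapw_relator_conj]).  Another word that fills
the torus acts in the same way on the image of delta^1, which is a plane, and
therefore on the whole of sl_2 ([wact_winv_filling]).  So F_2 is the pairing with
c (B - B^-1) - h_0^-1 P, of which the final determinant retains only the upper
right entry; up to a power of m this is a multiple of the same entry
2 v_11 phi_v of V (A - A^-1) V^-1 ([axis1_conj_entry]).  These determinants
combine in [riley_torsion].

The sign is made of an ordering of unit cochains, the orientation of the torus,
the parity of Turaev's exponent, which the dimensions of the cohomology fix, and
the sign of the torsion with trivial coefficients, which does not see the lifts
([trivial_torsion]).  None of these involves m or u. *)

(** * Fox calculus with equivariant cochains *)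

Lemma linvK : involutive linv.
Proof. by case=> i b; rewrite /linv /= negbK. Qed.

Lemma winv_cat g h : winv (g ++ h) = winv h ++ winv g.
Proof. by rewrite /winv map_cat rev_cat. Qed.

Lemma winv_cons l g : winv (l :: g) = winv g ++ [:: linv l].
Proof. by rewrite -cat1s winv_cat. Qed.

Lemma winvK : involutive winv.
Proof. by move=> g; rewrite /winv map_rev revK mapK //; exact: linvK. Qed.

Section FoxCalculus.
Variables (F : fieldType) (d : nat) (act : letter -> 'rV[F]_d -> 'rV[F]_d).
Hypothesis act_linear : forall l, linear (act l).
Hypothesis actK : forall l x, act l (act (linv l) x) = x.

Let actD l : {morph act l : x y / x + y}.
Proof. by move=> x y; have := act_linear l 1 x y; rewrite !scale1r. Qed.

Let act0 l : act l 0 = 0.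
Proof. by apply: (addrI (act l 0)); rewrite -actD !addr0. Qed.

Let actN l : {morph act l : x / - x}.
Proof.
move=> x; apply: (addrI (act l x)).
by rewrite -actD !subrr act0.
Qed.

Let actB l : {morph act l : x y / x - y}.
Proof. by move=> x y; rewrite actD actN. Qed.

Let actZ l a : {morph act l : x / a *: x}.
Proof. by move=> x; have := act_linear l a x 0; rewrite !addr0 act0 addr0. Qed.

Lemma wact_cat g h x : wact act (g ++ h) x = wact act g (wact act h x).
Proof. by rewrite /wact foldr_cat. Qed.

Lemma wactD g : {morph wact act g : x y / x + y}.
Proof. by elim: g => [|l g IH] x y //=; rewrite IH actD. Qed.

Lemma wactN g : {morph wact act g : x / - x}.
Proof. by elim: g => [|l g IH] x //=; rewrite IH actN. Qed.

Lemma wactZ g a : {morph wact act g : x / a *: x}.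
Proof. by elim: g => [|l g IH] x //=; rewrite IH actZ. Qed.

Lemma wactB g : {morph wact act g : x y / x - y}.
Proof. by move=> x y; rewrite wactD wactN. Qed.

Lemma wactKV g x : wact act (winv g) (wact act g x) = x.
Proof.
elim: g x => [|l g IH] x //=; rewrite winv_cons wact_cat /=.
by rewrite -{2}(linvK l) actK IH.
Qed.

Lemma wactVK g x : wact act g (wact act (winv g) x) = x.
Proof. by have := wactKV (winv g) x; rewrite winvK. Qed.

Lemma on_path_cat x g h :
  on_path act x (g ++ h) = on_path act x g + wact act g (on_path act x h).
Proof.
elim: g => [|l g IH] /=; first by rewrite add0r.
by rewrite IH; case: ifP => _; rewrite !actD ?addrA // addrAC.
Qed.

Lemma on_path_cons x l g :
  on_path act x (l :: g) = on_path act x [:: l] + act l (on_path act x g).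
Proof. by rewrite -cat1s on_path_cat. Qed.

Lemma on_path_letter x l :
  on_path act x [:: l] = if l.2 then row l.1 x else - act l (row l.1 x).
Proof. by rewrite /= sub0r actN act0 addr0. Qed.

Lemma on_path_cancel x l g : on_path act x (l :: linv l :: g) = on_path act x g.
Proof.
case: l => i [] /=; first by rewrite (actK (i, true)) addrC subrK.
by rewrite actB actD (actK (i, false)) [X in X - _]addrC addrK.
Qed.

Lemma wact_cancel l g x : wact act (l :: linv l :: g) x = wact act g x.
Proof. by rewrite /= actK. Qed.

(** Two cancelling letters contribute opposite terms at the same translate, so
that only the homotopy class of a path matters. *)
Lemma on_path_reduce x g :
  on_path act x (reduce g) = on_path act x g /\
  wact act (reduce g) =1 wact act g.
Proof.
elim: g => [|l g [IH1 IH2]] //=.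
rewrite -/(reduce g) -IH1.
case E: (reduce g) IH2 => [|l' s] IH2; first by split=> // y; congr (act l _); exact: IH2.
case: eqP => [l'E|_]; last by split=> // y; congr (act l _); exact: IH2.
split=> [|y].
  by have := on_path_cancel x l s; rewrite -l'E /= => ->.
by rewrite -[RHS]/(act l (wact act g y)) -IH2 l'E /= actK.
Qed.

Lemma on_path_free_eq x g h :
  free_eq g h -> on_path act x g = on_path act x h.
Proof.
by move=> /eqP E; have [<- _] := on_path_reduce x g; rewrite E;
   have [-> _] := on_path_reduce x h.
Qed.

Lemma on_path_winv x g :
  on_path act x (winv g) = - wact act (winv g) (on_path act x g).
Proof.
apply/eqP; rewrite -addr_eq0 -on_path_cat; apply/eqP.
elim: g => [|l g IH] //; rewrite winv_cons -catA cat1s on_path_cat.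
by rewrite -{2}(linvK l) on_path_cancel -on_path_cat.
Qed.

Lemma on_path_linear g : linear (fun x => on_path act x g).
Proof.
move=> a x y; elim: g => [|l g IH] /=; first by rewrite scaler0 addr0.
rewrite IH linearP /=; case: ifP => _.
  by rewrite act_linear scalerDr addrACA.
by rewrite -act_linear scalerDr scalerN opprD addrACA.
Qed.

Lemma delta1E r x : delta1 act r x = on_path act x r.
Proof.
pose f := HB.pack_for {linear 'M[F]_(2, d) -> 'M[F]_(1, d)}
  (fun x => on_path act x r)
  (GRing.isLinear.Build F _ _ *:%R (fun x => on_path act x r)
     (on_path_linear r)).
exact: (lfunE f).
Qed.

Lemma row_delta0 x j : row j (delta0 act x) = act (j, true) x - x.
Proof.
pose f := (fun x : 'M[F]_(1, d) =>
  \matrix_(j < 2) (act (j, true) x - x) : 'M[F]_(2, d)).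
have lin : linear f.
  by move=> a y z; apply/matrixP => i k; rewrite !mxE act_linear !mxE; ring.
pose g := HB.pack_for {linear 'M[F]_(1, d) -> 'M[F]_(2, d)} f
  (GRing.isLinear.Build F _ _ *:%R f lin).
by rewrite /delta0 (lfunE g) /= rowK.
Qed.

(** Rotating a relator conjugates it by the part that is moved, which translates
the lift of the 2-cell that it bounds. *)
Lemma on_path_rot x a b :
  (forall y, wact act (a ++ b) y = y) ->
  on_path act x (b ++ a) = wact act b (on_path act x (a ++ b)).
Proof.
move=> ab1; rewrite !on_path_cat wactD addrC; congr (_ + _).
set y := on_path _ _ b; have := ab1 (wact act a y).
by rewrite wact_cat => /(congr1 (wact act (winv a))); rewrite !wactKV.
Qed.

(** A congruence on words that free equality implies; it allows cancellations
inside a word without computing normal forms. *)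
Definition path_equiv g h :=
  (forall x, on_path act x g = on_path act x h) /\ wact act g =1 wact act h.

Lemma path_equiv_cat g g' h h' : path_equiv g g' -> path_equiv h h' ->
  path_equiv (g ++ h) (g' ++ h').
Proof.
move=> [xg ag] [xh ah]; split=> [x|y]; first by rewrite !on_path_cat xg xh ag.
by rewrite !wact_cat ag ah.
Qed.

Lemma path_equiv_sym g h : path_equiv g h -> path_equiv h g.
Proof. by move=> [xg ag]; split=> [x|y]; rewrite ?xg ?ag. Qed.

Lemma path_equiv_trans h g k :
  path_equiv g h -> path_equiv h k -> path_equiv g k.
Proof. by move=> [xg ag] [xh ah]; split=> [x|y]; rewrite ?xg ?ag. Qed.

Lemma path_equiv_catV g : path_equiv (g ++ winv g) [::].
Proof.
split=> [x|y]; last by rewrite wact_cat wactVK.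
by rewrite on_path_cat on_path_winv wactN wactVK subrr.
Qed.

Lemma path_equiv_Vcat g : path_equiv (winv g ++ g) [::].
Proof. by rewrite -{2}(winvK g); exact: path_equiv_catV. Qed.

(** The longitude ends with a power of the meridian, which this removes from its
commutator with the meridian. *)
Lemma path_equiv_lpow l n :
  path_equiv (lpow l n ++ [:: l] ++ winv (lpow l n)) [:: l].
Proof.
have refl g : path_equiv g g by [].
have comm : path_equiv (lpow l n ++ [:: l]) ([:: l] ++ lpow l n).
  have nseqSr k y : nseq k y ++ [:: y] = y :: nseq k y :> word.
    by elim: k => //= k ->.
  case: n => n; first by rewrite /lpow nseqSr; by [].
  apply: (@path_equiv_trans (nseq n (linv l))).
    have -> : lpow l (Negz n) = nseq n (linv l) ++ [:: linv l] by rewrite nseqSr.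
    rewrite -catA.
    rewrite -[X in path_equiv _ X]cats0.
    apply: path_equiv_cat (refl _) _.
    by have := path_equiv_Vcat [:: l].
  apply: path_equiv_sym.
  by split=> [x|y]; [exact: on_path_cancel | exact: wact_cancel].
rewrite catA; apply: path_equiv_trans (path_equiv_cat comm (refl _)) _.
rewrite -catA -[X in path_equiv _ X]cats0.
exact: path_equiv_cat (refl _) (path_equiv_catV _).
Qed.

Lemma on_path_conj x g s : (forall y, wact act s y = y) ->
  on_path act x (g ++ s ++ winv g) = wact act g (on_path act x s).
Proof.
move=> s1; rewrite !on_path_cat s1 on_path_winv wactD wactN wactVK.
by rewrite addrC subrK.
Qed.

(** Here [s] is the conjugate of the inverse of [r] by [c], so that it bounds the
translate by [c] of the 2-cell with the opposite orientation. *)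
Lemma on_path_rotV x r s a c : (forall y, wact act r y = y) ->
  s = c ++ a -> winv r = a ++ c ->
  on_path act x s = - wact act c (on_path act x r).
Proof.
move=> r1 -> rE.
have rV1 y : wact act (winv r) y = y by have := wactKV r y; rewrite r1.
rewrite on_path_rot -rE //.
by rewrite on_path_winv wactN rV1.
Qed.

(** In the quotient by the relator, [w g_1 w^-1] acts as [g_2]. *)
Lemma on_path_conj_relator x w : let r := w ++ [:: g1] ++ winv w ++ [:: linv g2] in
  (forall y, wact act r y = y) ->
  on_path act x r = on_path act x w + wact act w (row 0 x)
                    - act g2 (on_path act x w) - row 1 x.
Proof.
move=> r r1.
have g2E y : wact act (w ++ [:: g1] ++ winv w) y = act g2 y.
  have := r1 (act g2 y); rewrite /r !catA wact_cat -!catA.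
  by rewrite /= -{1}(linvK g2) actK.
have rE : r = (w ++ [:: g1] ++ winv w) ++ [:: linv g2] by rewrite -!catA.
rewrite rE on_path_cat [X in _ + X]g2E on_path_letter [(linv g2).2]/= actN actK.
congr (_ - _); rewrite !on_path_cat !wactD addrA on_path_winv !wactN.
congr (_ + _ - _); first by rewrite -wactD act0 addr0.
by rewrite -g2E !wact_cat.
Qed.

(** The four sides of a square.  Opposite sides are translates of each other, so
they cancel after pairing with a vector that both words fix. *)
Lemma on_path_wcomm x g h : on_path act x (wcomm g h) =
  on_path act x g + wact act g (on_path act x h)
  - wact act (g ++ h ++ winv g) (on_path act x g)
  - wact act (wcomm g h) (on_path act x h).
Proof.
rewrite /wcomm !on_path_cat !wactD !addrA !on_path_winv !wactN.
by rewrite !wact_cat.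
Qed.

(** The sum over the edges of a path telescopes. *)
Lemma on_path_delta0 x g : on_path act (delta0 act x) g = wact act g x - x.
Proof.
elim: g => [|l g IH]; first by rewrite /= subrr.
rewrite on_path_cons IH on_path_letter; case: l => i [] /=.
  by rewrite row_delta0 actB addrC addrA subrK.
by rewrite row_delta0 !actB (actK (i, false)) opprB addrC addrA subrK.
Qed.

End FoxCalculus.

(** * The relator of a two-bridge knot as a cyclic word *)

Definition swap_letter (l : letter) : letter := (if l.1 == 0 then 1 else 0, l.2).
Definition swapw : word -> word := map swap_letter.

Lemma floor_divP (d : nat) (c e : int) : 0 <= e < d%:Z ->
  ((c * d%:Z + e) %/ d%:Z)%Z = c.
Proof.
move=> /[dup] /andP[e0 ed] he; rewrite divzMDl; last by lia.
by rewrite divz_small ?addr0 // absz_nat.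
Qed.

Lemma floor_oppB1 (d : nat) (x : int) : (0 < d)%N ->
  ((- x - 1) %/ d%:Z)%Z = - (x %/ d%:Z)%Z - 1.
Proof.
move=> d0; have d0' : d%:Z != 0 by lia.
have := modz_ge0 x d0'; have := @ltz_pmod x d%:Z d0; have := divz_eq x d%:Z.
move: (x %/ d%:Z)%Z (x %% d%:Z)%Z => c e {1}-> h1 h2.
have -> : - (c * d%:Z + e) - 1 = (- c - 1) * d%:Z + (d%:Z - 1 - e) by ring.
by rewrite floor_divP //; lia.
Qed.

Lemma floorB1 (d : nat) (x : int) : (0 < d)%N -> ~~ (d%:Z %| x)%Z ->
  ((x - 1) %/ d%:Z)%Z = (x %/ d%:Z)%Z.
Proof.
move=> d0; have d0' : d%:Z != 0 by lia.
move=> /dvdz_mod0P/eqP.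
have := modz_ge0 x d0'; have := @ltz_pmod x d%:Z d0; have := divz_eq x d%:Z.
move: (x %/ d%:Z)%Z (x %% d%:Z)%Z => c e {1}-> h1 h2 h3.
have -> : c * d%:Z + e - 1 = c * d%:Z + (e - 1) by ring.
by rewrite floor_divP //; lia.
Qed.

Lemma signz_eq1 (z : int) : (((-1 : int) ^ z) == 1) = ~~ odd `|z|%N.
Proof.
case: z => n; first by rewrite -exprnP -signr_odd /=; case: (odd n).
rewrite NegzE -exprz_inv -exprnP; have -> : (-1 : int)^-1 = -1 by [].
by rewrite -signr_odd abszN absz_nat; case: (odd _).
Qed.

Lemma signz_eqN1 (z : int) : odd `|z|%N -> ((-1 : int) ^ z) = -1.
Proof.
case: z => n; first by rewrite -exprnP -signr_odd /= => ->.
rewrite NegzE -exprz_inv -exprnP; have -> : (-1 : int)^-1 = -1 by [].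
by rewrite -signr_odd abszN absz_nat => ->.
Qed.

Lemma oddzD (a b : int) : odd `|(a + b)%R|%N = odd `|a|%N (+) odd `|b|%N.
Proof. by lia. Qed.

Lemma oddzN (a : int) : odd `|(- a)%R|%N = odd `|a|%N.
Proof. by rewrite abszN. Qed.

Lemma oddzM (a b : int) : odd `|(a * b)%R|%N = odd `|a|%N && odd `|b|%N.
Proof. by rewrite abszM oddM. Qed.

Definition oddzE := (oddzD, oddzN, oddzM, absz_nat, odd_double).

Ltac clear_lia :=
  repeat match goal with
  | H : is_true (odd _) |- _ => clear H
  | H : is_true (coprime _ _) |- _ => clear H
  | H : modz _ _ = modz _ _ |- _ => clear H
  end; lia.

Section RelatorWords.
Variables (p : nat) (q : int).
Hypotheses (p_gt0 : (0 < p)%N) (p_odd : odd p) (q_odd : odd `|q|%N).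
Hypothesis pq_coprime : coprime p `|q|%N.

(** The [n]-th letter of the relator read cyclically.  Subtracting 1 changes the
floor of [n q / p] only when [p] divides [n]; there it gives the right signs to
the two letters of the relator that lie outside [w] and its inverse. *)
Definition cyclic_letter (n : int) : letter :=
  (if odd `|n|%N then 0 else 1, ~~ odd `|(((n * q - 1) %/ p%:Z)%Z)%R|%N).
Local Notation L := cyclic_letter.

Let p0 : p%:Z != 0. Proof. by lia. Qed.

Lemma dvdpF (i : nat) : (0 < i < p)%N -> ~~ (p%:Z %| i%:Z * q)%Z.
Proof.
move=> ip; rewrite dvdzE abszM !absz_nat Gauss_dvdl //.
by apply/negP => /dvdn_leq; lia.
Qed.

Lemma eps_cyclic i : (0 < i < p)%N ->
  ((if odd i then 0 else 1) : 'I_2, eps p q i == 1) = L i%:Z.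
Proof. by move=> ip; rewrite /eps signz_eq1 /L absz_nat floorB1 // dvdpF. Qed.

Let double_p : p.*2%:Z = 2 * p%:Z. Proof. by rewrite -mul2n PoszM. Qed.

Lemma cyclic_periodic n : L (n + p.*2%:Z) = L n.
Proof.
rewrite /L !oddzE addbF; congr (_, ~~ _).
have -> : (n + p.*2%:Z) * q - 1 = (q * 2) * p%:Z + (n * q - 1).
  by rewrite double_p; ring.
by rewrite divzMDl // !oddzE andbF.
Qed.

(** Adding the odd number [q] to a floor changes its parity; this is what makes
the second half of the relator the inverse of the first. *)
Lemma cyclic_half n : ~~ (p%:Z %| n * q)%Z -> L (p%:Z + n) = linv (L (p%:Z - n)).
Proof.
move=> pn; rewrite /L /linv /= !oddzE; congr (_, _).
have -> : (p%:Z + n) * q - 1 = q * p%:Z + (n * q - 1) by ring.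
have -> : (p%:Z - n) * q - 1 = q * p%:Z + (- (n * q) - 1) by ring.
rewrite !divzMDl // floor_oppB1 // floorB1 // !oddzE q_odd.
by case: (odd _).
Qed.

Lemma cyclic_palindrome n : ~~ (p%:Z %| n * q)%Z -> L (p%:Z - n) = swap_letter (L n).
Proof.
move=> pn; rewrite /L /swap_letter /= !oddzE p_odd; congr (_, _).
  by case: (odd _).
have -> : (p%:Z - n) * q - 1 = q * p%:Z + (- (n * q) - 1) by ring.
rewrite !divzMDl // floor_oppB1 // floorB1 // !oddzE q_odd.
by case: (odd _).
Qed.

Lemma cyclic_p : L p%:Z = g1.
Proof.
rewrite /L absz_nat p_odd; congr (_, _).
have -> : p%:Z * q - 1 = (q - 1) * p%:Z + (p%:Z - 1) by ring.
rewrite floor_divP; first by rewrite !oddzE q_odd.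
by clear -p_gt0; lia.
Qed.

Lemma cyclic_2p : L p.*2%:Z = linv g2.
Proof.
rewrite /L !oddzE; congr (_, _).
have -> : p.*2%:Z * q - 1 = (q * 2 - 1) * p%:Z + (p%:Z - 1).
  by rewrite double_p; ring.
rewrite floor_divP; first by rewrite !oddzE andbF.
by clear -p_gt0; lia.
Qed.

Lemma size_tb_prefix n : size (tb_prefix p q n) = n.
Proof. by rewrite /tb_prefix size_map size_iota. Qed.

Lemma nth_tb_prefix n i : (i < n < p)%N ->
  nth g1 (tb_prefix p q n) i = L i.+1%:Z.
Proof.
move=> /andP[i_n np]; rewrite (nth_map 0%N) ?size_iota // nth_iota // add1n.
by rewrite eps_cyclic //; clear_lia.
Qed.

Lemma size_winv g : size (winv g) = size g.
Proof. by rewrite /winv size_rev size_map. Qed.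

Lemma nth_winv g i : (i < size g)%N ->
  nth g1 (winv g) i = linv (nth g1 g (size g - i.+1)).
Proof.
move=> ig; rewrite /winv nth_rev ?size_map // (nth_map g1) //.
by clear_lia.
Qed.

Lemma size_relator : size (relator p q) = p.*2.
Proof. by rewrite /relator !size_cat size_winv size_tb_prefix /=; clear_lia. Qed.

Lemma nth_relator i : (i < p.*2)%N -> nth g1 (relator p q) i = L i.+1%:Z.
Proof.
move=> ip; rewrite /relator !nth_cat size_winv size_tb_prefix /tb_word.
case: ifP => i1; first by rewrite nth_tb_prefix //; clear_lia.
case: ifP => [/= i2|/= i2].
  have -> : i = p.-1 by clear_lia.
  by rewrite subnn prednK // cyclic_p.
case: ifP => i3.
  rewrite nth_winv ?size_tb_prefix; last by clear_lia.
  rewrite nth_tb_prefix; last by clear_lia.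
  have [j ij] : exists j, i = (p + j)%N by exists (i - p)%N; clear_lia.
  subst i.
  have -> : (p + j).+1%:Z = p%:Z + j.+1%:Z by clear_lia.
  rewrite cyclic_half; last by apply: dvdpF; clear_lia.
  by congr (linv (L _)); clear_lia.
have -> : i = p.*2.-1 by clear_lia.
have -> : (p.*2.-1 - p.-1 - 1 - p.-1)%N = 0%N by clear_lia.
by rewrite prednK ?cyclic_2p //; clear_lia.
Qed.

Lemma rev_tb_word : rev (tb_word p q) = swapw (tb_word p q).
Proof.
apply: (@eq_from_nth _ g1); first by rewrite size_rev /swapw size_map.
move=> i; rewrite size_rev size_tb_prefix => ip.
rewrite nth_rev ?size_tb_prefix // (nth_map g1) ?size_tb_prefix //.
rewrite !nth_tb_prefix; [|by clear_lia..].
rewrite -cyclic_palindrome; last by apply: dvdpF; clear_lia.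
by congr (L _); clear_lia.
Qed.

Lemma swapw_relator :
  swapw (relator p q) =
  rev (tb_word p q) ++ [:: g2] ++ winv (rev (tb_word p q)) ++ [:: linv g1].
Proof.
rewrite rev_tb_word /relator /swapw !map_cat /=; do ![congr (_ ++ _)].
by rewrite /winv map_rev -!map_comp.
Qed.

Lemma take_tb_word n : (n < p)%N -> take n (tb_word p q) = tb_prefix p q n.
Proof.
move=> np; rewrite /tb_word /tb_prefix -map_take take_iota.
by congr [seq _ | _ <- iota _ _]; clear_lia.
Qed.

Section Symmetry.
Variables (k : nat) (kappa : int).
Hypotheses (kp : (0 < k < p)%N) (kappa1 : kappa = 1 \/ kappa = -1).
Hypothesis kq : (k%:Z * q = kappa %[mod p.*2%:Z])%Z.

Let kqE : exists c, k%:Z * q = kappa + c * p.*2%:Z.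
Proof.
move: kq => /eqP; rewrite eqz_mod_dvd => /dvdzP[c E].
by exists c; rewrite -E; ring.
Qed.

Let odd_kappa : odd `|kappa|%N. Proof. by case: kappa1 => ->. Qed.

Lemma odd_k : odd k.
Proof.
have [c E] := kqE; have : odd `|(k%:Z * q)%R|%N.
  by rewrite E !oddzE odd_kappa andbF.
by rewrite !oddzE => /andP[].
Qed.

(** As [kappa k q = 1] modulo [2 p], the argument of the floor at
[kappa k - n] is [- n q], and the floors of [y / p] and [(- y - 1) / p] have
opposite parities. *)
Lemma cyclic_swap n : swap_letter (L n) = linv (L (kappa * k%:Z - n)).
Proof.
rewrite /L /swap_letter /linv /=; congr (_, _).
  by rewrite !oddzE odd_kappa odd_k; case: (odd _).
rewrite negbK; have [c E] : exists c, kappa * (k%:Z * q) = 1 + c * p.*2%:Z.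
  have [c ->] := kqE; exists (kappa * c).
  by case: kappa1 => ->; ring.
have -> : (kappa * k%:Z - n) * q - 1 = (c * 2) * p%:Z + (- (n * q - 1) - 1).
  have -> : (kappa * k%:Z - n) * q - 1 = kappa * (k%:Z * q) - n * q - 1 by ring.
  by rewrite E double_p; ring.
by rewrite divzMDl // floor_oppB1 // !oddzE andbF addbT.
Qed.

(** By [cyclic_swap], exchanging the generators amounts to reversing the cyclic
word, inverting its letters and shifting it by [k], in the direction of
[kappa]. *)
Lemma swapw_relator_rot n : (n < p.*2)%N ->
  (exists c : int, n%:Z + kappa * k%:Z = 1 + c * p.*2%:Z) ->
  swapw (relator p q) = rot n (winv (relator p q)).
Proof.
move=> np [c E]; apply: (@eq_from_nth _ g1).
  by rewrite /swapw size_map size_rot size_winv.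
move=> i; rewrite /swapw size_map size_relator => ip.
rewrite (nth_map g1) ?size_relator // nth_relator // cyclic_swap.
rewrite /rot nth_cat size_drop size_winv size_relator.
have per (z c' : int) : L (z + c' * p.*2%:Z) = L z.
  elim/int_rect: c' => [|m IH|m IH]; first by rewrite mul0r addr0.
    by rewrite -IH -[RHS]cyclic_periodic; congr L; rewrite intS; ring.
  by rewrite -IH -[LHS]cyclic_periodic; congr L; rewrite intS; ring.
case: ifP => i1.
  rewrite nth_drop nth_winv size_relator; last by clear_lia.
  rewrite nth_relator; last by clear_lia.
  rewrite -[L (p.*2 - _).+1%:Z](per _ (c - 1)); congr (linv (L _)).
  have -> : (p.*2 - (n + i).+1).+1%:Z = p.*2%:Z - n%:Z - i%:Z by clear_lia.
  have -> : n%:Z = 1 + c * p.*2%:Z - kappa * k%:Z by rewrite -E; ring.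
  by rewrite -[i.+1]addn1 PoszD; ring.
rewrite nth_take; last by clear_lia.
rewrite nth_winv size_relator; last by clear_lia.
rewrite nth_relator; last by clear_lia.
rewrite -[L (p.*2 - _).+1%:Z](per _ (c - 2)); congr (linv (L _)).
have -> : (p.*2 - (i - (p.*2 - n)).+1).+1%:Z =
  p.*2%:Z + p.*2%:Z - n%:Z - i%:Z by clear_lia.
have -> : n%:Z = 1 + c * p.*2%:Z - kappa * k%:Z by rewrite -E; ring.
by rewrite -[i.+1]addn1 PoszD; ring.
Qed.

Lemma eps_k : eps p q k = kappa.
Proof.
have [c E] := kqE; have p1 : (1 < p)%N by clear -kp; clear_lia.
have E2 : k%:Z * q = (c * 2) * p%:Z + kappa by rewrite E double_p; ring.
rewrite /eps E2; case: kappa1 => ->.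
  rewrite floor_divP; last by clear -p1; clear_lia.
  by apply/eqP; rewrite signz_eq1 !oddzE andbF.
have -> : c * 2 * p%:Z - 1 = (c * 2 - 1) * p%:Z + (p%:Z - 1) by ring.
rewrite floor_divP; last by clear -p1; clear_lia.
by apply: signz_eqN1; rewrite !oddzE andbF.
Qed.

(** The rotation of [winv (relator p q)] in [swapw_relator_rot] moves its last
[k - 1] letters, which spell [v^-1], when [kappa] is 1, and its first [k + 1]
letters, which spell [g_2 v g_1^-1], when [kappa] is -1; in both cases the
conjugating word can be expressed by [v]. *)
Definition symmetry_conjugator : word :=
  let v := tb_prefix p q k.-1 in
  if kappa == 1 then winv v else winv (g2 :: v ++ [:: linv g1]).

Lemma swapw_relator_conj : exists a c : word,
  [/\ swapw (relator p q) = c ++ a, winv (relator p q) = a ++ c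
    & symmetry_conjugator = c] \/
  [/\ swapw (relator p q) = a ++ c, winv (relator p q) = c ++ a
    & symmetry_conjugator = winv c].
Proof.
have rE : winv (relator p q) =
    g2 :: tb_word p q ++ linv g1 :: winv (tb_word p q).
  by rewrite /relator !winv_cat winvK /winv /= -!catA.
rewrite /symmetry_conjugator; case: kappa1 => kE; rewrite kE /=.
  pose n := (p.*2 - k.-1)%N.
  have np : (0 < k.-1)%N -> (n < p.*2)%N by clear_lia.
  exists (take n (winv (relator p q))), (drop n (winv (relator p q))); left.
  rewrite cat_take_drop; split=> //.
    case: (posnP k.-1) => [k0|/np n2]; last first.
      by rewrite (@swapw_relator_rot n) //; exists 1; rewrite kE; clear_lia.
    rewrite (@swapw_relator_rot 0%N); last by exists 0; clear_lia.
      by rewrite rot0 /n k0 subn0 drop_oversize ?take_oversize // size_winv size_relator.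
    by clear_lia.
  rewrite /n /winv -size_relator -(size_map linv) -rev_take -map_take.
  congr (rev (map _ _)); rewrite /relator take_cat size_tb_prefix.
  case: ifP => ?; first by rewrite take_tb_word //; clear_lia.
  by exfalso; clear_lia.
have kp1 : (k.+1 < p.*2)%N by clear_lia.
exists (drop k.+1 (winv (relator p q))), (take k.+1 (winv (relator p q))); right.
rewrite cat_take_drop; split=> //.
  by rewrite (@swapw_relator_rot k.+1) //; exists 0; rewrite kE; clear_lia.
congr winv; rewrite rE [take _ _]/=; congr (_ :: _).
rewrite take_cat size_tb_prefix.
have -> : k = k.-1.+1 by clear_lia.
have kL : (if odd k then 0 else 1 : 'I_2, eps p q k == 1) = linv g1.
  by rewrite odd_k eps_k kE.
have tE : tb_prefix p q k = tb_prefix p q k.-1 ++ [:: linv g1].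
  have {1}-> : k = (k.-1 + 1)%N by clear_lia.
  rewrite /tb_prefix iotaD map_cat add1n prednK; last by clear_lia.
  by rewrite -kL.
rewrite prednK; last by clear_lia.
case: ifP => kp2; first by rewrite take_tb_word ?tE //; clear_lia.
have -> : (k - p.-1)%N = 0%N by clear_lia.
rewrite take0 cats0 -tE /tb_word; congr tb_prefix; clear_lia.
Qed.

End Symmetry.

End RelatorWords.

(** * Two by two matrices and the adjoint representation *)

Lemma ord2_cases (i : 'I_2) : i = 0 \/ i = 1.
Proof. by case: i => [[|[|//]] ?]; [left | right]; apply/val_inj. Qed.

Section TwoByTwo.
Variable K : fieldType.
Implicit Types M N : 'M[K]_2.

Lemma mx2P M N : M 0 0 = N 0 0 -> M 0 1 = N 0 1 -> M 1 0 = N 1 0 ->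
  M 1 1 = N 1 1 -> M = N.
Proof.
move=> e00 e01 e10 e11; apply/matrixP => i j.
by case: (ord2_cases i) => ->; case: (ord2_cases j) => ->.
Qed.

Lemma mx22E (a b c d : K) :
  ((mx22 a b c d 0 0 = a) * (mx22 a b c d 0 1 = b)) *
  ((mx22 a b c d 1 0 = c) * (mx22 a b c d 1 1 = d)).
Proof. by rewrite /mx22 !mxE. Qed.

Lemma mul22E M N i j : (M * N) i j = M i 0 * N 0 j + M i 1 * N 1 j.
Proof.
rewrite (_ : M * N = M *m N) // mxE big_ord_recl big_ord1; congr (_ + M _ _ * N _ _);
  exact/val_inj.
Qed.

Lemma mx22M (a b c d a' b' c' d' : K) : mx22 a b c d * mx22 a' b' c' d' =
  mx22 (a * a' + b * c') (a * b' + b * d') (c * a' + d * c') (c * b' + d * d').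
Proof. by apply: mx2P; rewrite mul22E !mx22E. Qed.

Lemma det22 M : \det M = M 0 0 * M 1 1 - M 0 1 * M 1 0.
Proof.
rewrite (expand_det_row M 0) big_ord_recl big_ord1 /cofactor !det_mx11 !mxE.
have -> : lift 0 0 = 1 :> 'I_2 by apply/val_inj.
have -> : lift 1 0 = 0 :> 'I_2 by apply/val_inj.
by rewrite expr0 expr1; ring.
Qed.

Lemma tr22 M : \tr M = M 0 0 + M 1 1.
Proof.
rewrite /mxtrace big_ord_recl big_ord1; congr (_ + M _ _); exact/val_inj.
Qed.

Lemma unit22 M : \det M = 1 -> M \is a GRing.unit.
Proof. by move=> M1; rewrite -[_ \is a _]/(M \in unitmx) unitmxE M1 unitr1. Qed.

Lemma inv22 M : \det M = 1 -> M^-1 = mx22 (M 1 1) (- M 0 1) (- M 1 0) (M 0 0).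
Proof.
move=> M1; have uM := unit22 M1.
apply: (mulrI uM); rewrite divrr //; rewrite det22 in M1.
apply: mx2P; rewrite mul22E !mx22E !mxE /=.
- by rewrite -M1; ring.
- by ring.
- by ring.
- by rewrite -M1; ring.
Qed.

Lemma row3P (x y : 'rV[K]_3) : x 0 0 = y 0 0 -> x 0 1 = y 0 1 ->
  x 0 2%:R = y 0 2%:R -> x = y.
Proof.
move=> e0 e1 e2; apply/rowP => -[[|[|[|//]]] ip].
- by move: e0; congr (x _ _ = y _ _); apply/val_inj.
- by move: e1; congr (x _ _ = y _ _); apply/val_inj.
- by move: e2; congr (x _ _ = y _ _); apply/val_inj.
Qed.

Lemma sl2_mxE (x : 'rV[K]_3) :
  ((sl2_mx x 0 0 = x 0 1) * (sl2_mx x 0 1 = x 0 0)) *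
  ((sl2_mx x 1 0 = x 0 2%:R) * (sl2_mx x 1 1 = - x 0 1)).
Proof. by rewrite /sl2_mx !mx22E. Qed.

Lemma sl2_coordE M :
  (sl2_coord M 0 0 = M 0 1) * (sl2_coord M 0 1 = M 0 0) *
  (sl2_coord M 0 2%:R = M 1 0).
Proof. by rewrite /sl2_coord !mxE. Qed.

Lemma sl2_mxK x : sl2_coord (sl2_mx x) = x :> 'rV[K]_3.
Proof. by apply: row3P; rewrite !sl2_coordE !sl2_mxE. Qed.

Lemma sl2_mx_inj : injective (@sl2_mx K).
Proof. exact: can_inj sl2_mxK. Qed.

Lemma sl2_coordK M : \tr M = 0 -> sl2_mx (sl2_coord M) = M.
Proof.
rewrite tr22 addrC => /eqP; rewrite addr_eq0 => /eqP M11.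
by apply: mx2P; rewrite sl2_mxE !sl2_coordE // M11.
Qed.

Lemma tr_sl2_mx (x : 'rV[K]_3) : \tr (sl2_mx x) = 0.
Proof. by rewrite tr22 !sl2_mxE subrr. Qed.

Lemma sl2_mx_linear : linear (@sl2_mx K).
Proof. by move=> a x y; apply: mx2P; rewrite !(sl2_mxE, mxE) //= ?mxE ?opprD ?mulrN. Qed.

Lemma sl2_mxD x y : sl2_mx (x + y) = sl2_mx x + sl2_mx y :> 'M[K]_2.
Proof. by have := sl2_mx_linear 1 x y; rewrite !scale1r. Qed.

Lemma sl2_mxN x : sl2_mx (- x) = - sl2_mx x :> 'M[K]_2.
Proof. by apply: mx2P; rewrite !(sl2_mxE, mxE) //= !mxE. Qed.

Lemma killing_tr (x y : 'rV[K]_3) : killing x y = 4%:R * \tr (sl2_mx x * sl2_mx y).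
Proof. by rewrite tr22 !mul22E !sl2_mxE /killing; ring. Qed.

End TwoByTwo.

Section Adjoint.
Variables (K : fieldType) (rho : 'I_2 -> 'M[K]_2).
Hypothesis det_rho : forall i, \det (rho i) = 1.

Lemma det_rho_letter l : \det (rho_letter rho l) = 1.
Proof. by rewrite /rho_letter; case: ifP; rewrite ?det_inv det_rho ?invr1. Qed.

Let uL l : rho_letter rho l \is a GRing.unit.
Proof. exact/unit22/det_rho_letter. Qed.

Lemma rho_letterV l : rho_letter rho (linv l) = (rho_letter rho l)^-1.
Proof. by rewrite /rho_letter /=; case: l => i [] //=; rewrite invrK. Qed.

Lemma rho_word_cat g h : rho_word rho (g ++ h) = rho_word rho g * rho_word rho h.
Proof. by rewrite /rho_word big_cat. Qed.

Lemma rho_word_cons l g : rho_word rho (l :: g) = rho_letter rho l * rho_word rho g.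
Proof. by rewrite /rho_word big_cons. Qed.

Lemma rho_word_nil : rho_word rho [::] = 1.
Proof. by rewrite /rho_word big_nil. Qed.

Lemma rho_word1 l : rho_word rho [:: l] = rho_letter rho l.
Proof. by rewrite rho_word_cons rho_word_nil mulr1. Qed.

Lemma det_rho_word g : \det (rho_word rho g) = 1.
Proof.
elim: g => [|l g IH]; first by rewrite rho_word_nil det1.
by rewrite rho_word_cons det_mulmx det_rho_letter IH mulr1.
Qed.

Lemma unit_rho_word g : rho_word rho g \is a GRing.unit.
Proof. exact/unit22/det_rho_word. Qed.

Lemma rho_word_winv g : rho_word rho (winv g) = (rho_word rho g)^-1.
Proof.
elim: g => [|l g IH]; first by rewrite rho_word_nil invr1.
rewrite winv_cons rho_word_cat rho_word1 rho_letterV IH rho_word_cons.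
by rewrite invrM // unit_rho_word.
Qed.

Lemma sl2_Ad l x : sl2_mx (Ad rho l x) =
  rho_letter rho l * sl2_mx x * (rho_letter rho l)^-1.
Proof.
rewrite sl2_coordK // mxtrace_mulC mulmxE mulKr //.
exact: tr_sl2_mx.
Qed.

Lemma Ad_linear l : linear (Ad rho l).
Proof.
move=> a x y; apply: sl2_mx_inj.
rewrite sl2_mx_linear !sl2_Ad sl2_mx_linear mulrDr mulrDl.
by rewrite -scalerAr -scalerAl.
Qed.

Lemma AdK l x : Ad rho l (Ad rho (linv l) x) = x.
Proof.
by apply: sl2_mx_inj; rewrite !sl2_Ad rho_letterV invrK mulrA mulVKr ?mulrK.
Qed.

Lemma sl2_wact g x : sl2_mx (wact (Ad rho) g x) =
  rho_word rho g * sl2_mx x * (rho_word rho g)^-1.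
Proof.
elim: g => [|l g IH]; first by rewrite rho_word_nil mul1r invr1 mulr1.
rewrite rho_word_cons invrM ?unit_rho_word // /= sl2_Ad.
by rewrite IH !mulrA.
Qed.

Lemma killing_wact g x y :
  killing (wact (Ad rho) g x) (wact (Ad rho) g y) = killing x y.
Proof.
have uG := unit_rho_word g.
rewrite !killing_tr !sl2_wact !mulrA mulrVK // mxtrace_mulC.
by rewrite mulmxE !mulrA mulVr // mul1r.
Qed.

Lemma killing_wactl g x y :
  killing x (wact (Ad rho) g y) = killing (wact (Ad rho) (winv g) x) y.
Proof.
by rewrite -[in LHS](wactVK AdK g x) killing_wact.
Qed.

End Adjoint.

Section Killing.
Variable K : fieldType.
Implicit Types x y z : 'rV[K]_3.

Lemma killingDr x y z : killing x (y + z) = killing x y + killing x z.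
Proof. by rewrite /killing !mxE; ring. Qed.

Lemma killingNr x y : killing x (- y) = - killing x y.
Proof. by rewrite /killing !mxE; ring. Qed.

Lemma killingBr x y z : killing x (y - z) = killing x y - killing x z.
Proof. by rewrite killingDr killingNr. Qed.

Lemma killingBl x y z : killing (y - z) x = killing y x - killing z x.
Proof. by rewrite /killing !mxE; ring. Qed.

Lemma killing_wact_id (rho : 'I_2 -> 'M[K]_2) g P y :
  (forall i, \det (rho i) = 1) -> wact (Ad rho) g P = P ->
  killing P (wact (Ad rho) g y) = killing P y.
Proof. by move=> rho1 gP; rewrite -{1}gP killing_wact. Qed.

End Killing.

Section Riley.
Variables (K : fieldType) (m u : K).
Hypothesis m0 : m != 0.
Local Notation rho := (riley m u).

Lemma det_riley i : \det (rho i) = 1.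
Proof.
by rewrite det22 /riley; case: ifP => _; rewrite !mx22E mulfV //; ring.
Qed.

Lemma rho_letter_riley l : rho_letter rho l =
  if l.1 == 0 then if l.2 then mx22 m 1 0 m^-1 else mx22 m^-1 (-1) 0 m
  else if l.2 then mx22 m 0 (- u) m^-1 else mx22 m^-1 0 u m.
Proof.
rewrite /rho_letter; case: l => i [] /=; first by rewrite /riley; case: ifP.
rewrite inv22 ?det_riley // /riley.
by case: ifP => _; rewrite !mx22E ?opprK oppr0.
Qed.

(** The transpose followed by the conjugation by a diagonal matrix exchanges the
images of the two generators, and it reverses products. *)
Lemma riley_transpose g :
  rho_word rho (rev (swapw g)) * mx22 1 0 0 (- u) =
  mx22 1 0 0 (- u) * (rho_word rho g)^T.
Proof.
elim: g => [|l g IH].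
  by rewrite !rho_word_nil trmx1 mulr1 mul1r.
rewrite /swapw /= rev_cons -cats1 rho_word_cat rho_word1 rho_word_cons.
rewrite trmx_mul mulmxE mulrA -IH -!mulrA; congr (_ * _).
rewrite !rho_letter_riley /swap_letter /=.
by case: l => i b; case: (ord2_cases i) => -> /=; case: b;
  apply: mx2P; rewrite !mul22E ![_^T _ _]mxE !mx22E; ring.
Qed.

(** The word is fixed by the reversal combined with the exchange of the
generators, so its image is fixed by the anti-automorphism of
[riley_transpose]. *)
Lemma riley_palindrome w : rev w = swapw w ->
  rho_word rho w 1 0 = - u * rho_word rho w 0 1.
Proof.
move=> pal; have := riley_transpose w; rewrite -pal revK.
move=> /matrixP/(_ 1 0); rewrite !mul22E !mx22E !mxE => /esym.
by rewrite !(mulr0, mulr1, mul0r, addr0, add0r).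
Qed.

(** The upper row of the relation involves [phi] alone; the symmetry of the word
reduces the lower row to the same polynomial. *)
Lemma riley_defect w : rev w = swapw w ->
  rho_word rho w * rho 0 - rho 1 * rho_word rho w = phi w m u *: mx22 0 1 u 0.
Proof.
move=> pal; have w10 := riley_palindrome pal.
rewrite /phi; move: (rho_word rho w) w10 => W w10; rewrite /riley /=.
apply: mx2P; rewrite ![(_ - _ : 'M_2) _ _]mxE ![(- _ : 'M_2) _ _]mxE
  ![(_ *: _ : 'M_2) _ _]mxE !mul22E !mx22E ?w10; by field.
Qed.

End Riley.

(** * Deforming the representation in the direction of u *)

Section RileyDerivative.
Variables (K : numFieldType) (m u : K).
Hypothesis m0 : m != 0.
Local Notation rho := (riley m u).

(** The logarithmic derivative in [u] of the images of the generators: on the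
second one, the derivative of the matrix times its inverse is [- m^-1 e_3]. *)
Definition du_cochain : 'M[K]_(2, 3) :=
  \matrix_(i, j) (if (i == 1) && (j == 2%:R) then - m^-1 else 0).

Lemma du_cochain_row0 : row 0 du_cochain = 0.
Proof. by apply/rowP => j; rewrite !mxE. Qed.

Lemma sl2_du_cochain1 : sl2_mx (row 1 du_cochain) = mx22 0 0 (- m^-1) 0.
Proof. by apply: mx2P; rewrite sl2_mxE !mxE ?mx22E ?oppr0. Qed.

Lemma is_derive_rho_letter l i j :
  is_derive u 1 (fun z : K => rho_letter (riley m z) l i j)
    ((sl2_mx (on_path (Ad rho) du_cochain [:: l]) * rho_letter rho l) i j).
Proof.
have sE : (fun z : K => rho_letter (riley m z) l i j) =
    fun z => (if l.1 == 0 then if l.2 then mx22 m 1 0 m^-1 else mx22 m^-1 (-1) 0 m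
  else if l.2 then mx22 m 0 (- z) m^-1 else mx22 m^-1 0 z m) i j.
  by apply/funext => z; rewrite rho_letter_riley.
rewrite sE (on_path_letter (@Ad_linear _ _ (det_riley u m0)))
  rho_letter_riley //.
case: l {sE} => a b /=; case: (ord2_cases a) => -> /=.
  rewrite du_cochain_row0.
  have -> : (if b then 0 else - Ad rho (0, b) 0) = 0 :> 'rV_3.
    case: b => //; apply: (@sl2_mx_inj K).
    have s0 : sl2_mx (0 : 'rV[K]_3) = 0 by apply: mx2P; rewrite sl2_mxE !mxE ?oppr0.
    by rewrite sl2_mxN (sl2_Ad (det_riley u m0)) s0 mulr0 mul0r oppr0.
  have -> : sl2_mx (0 : 'rV[K]_3) = 0 by apply: mx2P; rewrite sl2_mxE !mxE ?oppr0.
  by rewrite mul0r mxE; case: b; exact: is_derive_cst.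
case: b => /=.
  rewrite sl2_du_cochain1; case: (ord2_cases i) => ->; case: (ord2_cases j) => ->;
    rewrite mul22E !mx22E; under eq_fun do rewrite !mx22E.
  - by apply: is_derive_eq; ring.
  - by apply: is_derive_eq; ring.
  - by apply: is_derive_eq; field.
  - by apply: is_derive_eq; ring.
rewrite sl2_mxN (sl2_Ad (det_riley u m0)) sl2_du_cochain1.
rewrite rho_letter_riley //= inv22; last by rewrite det22 !mx22E; field.
rewrite !mx22E !mx22M.
case: (ord2_cases i) => ->; case: (ord2_cases j) => ->;
  rewrite mul22E ![(- mx22 _ _ _ _) _ _]mxE !mx22E; under eq_fun do rewrite !mx22E.
- by apply: is_derive_eq; ring.
- by apply: is_derive_eq; ring.
- by apply: is_derive_eq; field.
- by apply: is_derive_eq; ring.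
Qed.

(** Fox calculus is the product rule: a cochain tangent to a deformation of the
representation has the logarithmic derivative of the deformed matrix as its
value on every path. *)
Lemma is_derive_rho_word g i j :
  is_derive u 1 (fun z : K => rho_word (riley m z) g i j)
    ((sl2_mx (on_path (Ad rho) du_cochain g) * rho_word rho g) i j).
Proof.
have Adl := @Ad_linear _ _ (det_riley u m0).
elim: g i j => [|l g IH] i j.
  have -> : sl2_mx (on_path (Ad rho) du_cochain [::]) = 0.
    by apply: mx2P; rewrite sl2_mxE !mxE ?oppr0.
  rewrite mul0r mxE; under eq_fun do rewrite rho_word_nil.
  exact: is_derive_cst.
rewrite on_path_cons // sl2_mxD (sl2_Ad (det_riley u m0)) rho_word_cons mulrDl.
have uL : rho_letter rho l \is a GRing.unit by apply/unit22/det_rho_letter/det_riley.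
rewrite -!mulrA mulKr // mxE.
rewrite !mul22E.
have -> : (fun z => rho_word (riley m z) (l :: g) i j) =
  (fun z => rho_letter (riley m z) l i 0) * (fun z => rho_word (riley m z) g 0 j)
  + (fun z => rho_letter (riley m z) l i 1) * (fun z => rho_word (riley m z) g 1 j).
  by apply/funext => z; rewrite rho_word_cons mul22E.
have dL := is_derive_rho_letter l i.
refine (is_derive_eq (is_deriveD (is_deriveM (dL 0) (IH 0 j))
  (is_deriveM (dL 1) (IH 1 j))) _).
rewrite /= /GRing.scale /= !mul22E; ring.
Qed.

Lemma dphi_duE g : dphi_du g m u =
  (sl2_mx (on_path (Ad rho) du_cochain g) * rho_word rho g) 0 0
  - (m - m^-1) * (sl2_mx (on_path (Ad rho) du_cochain g) * rho_word rho g) 0 1.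
Proof.
rewrite /dphi_du derive1E; apply: derive_val.
have -> : (fun z => phi g m z) = (fun z => rho_word (riley m z) g 0 0)
   - (cst (m - m^-1)) * (fun z => rho_word (riley m z) g 0 1).
  by apply/funext => z; rewrite /phi.
have d0 := is_derive_rho_word g 0 0; have d1 := is_derive_rho_word g 0 1.
apply: is_derive_eq.
by rewrite /= /GRing.scale /= mulr0 addr0.
Qed.

End RileyDerivative.

(** * The torsion in terms of functionals *)

Section BasisDeterminants.
Variables (F : fieldType) (n d : nat).
Implicit Types xs es : seq 'M[F]_(n, d).

(** Both sides are the product of the volumes of the two families and of the
determinant of [f]; this compares volumes without inverting [f]. *)
Lemma basis_det_change (f : 'M[F]_(n, d) -> 'rV[F]_(n * d)) xs es : linear f ->
  basis_det xs * \det (\matrix_(i < n * d) f (nth 0 es i)) =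
  basis_det es * \det (\matrix_(i < n * d) f (nth 0 xs i)).
Proof.
move=> flin; pose g := fun v : 'rV[F]_(n * d) => f (vec_mx v).
have glin : linear g by move=> a x y; rewrite /g linearP flin.
pose gl := HB.pack_for {linear 'rV[F]_(n * d) -> 'rV[F]_(n * d)} g
  (GRing.isLinear.Build F _ _ *:%R g glin).
have fE ys : \det (\matrix_(i < n * d) f (nth 0 ys i)) =
    basis_det ys * \det (lin1_mx gl).
  rewrite /basis_det -det_mulmx; congr (\det _); apply/row_matrixP => i.
  by rewrite row_mul !rowK mul_rV_lin1 /= /g mxvecK.
by rewrite !fE mulrCA.
Qed.

Lemma basis_det_free xs : size xs = (n * d)%N -> free xs -> basis_det xs != 0.
Proof.
move=> xs_size xs_free; apply/det0P => -[v v0 vM].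
have sP : size xs == (n * d)%N by rewrite xs_size.
have /freeP/(_ (fun i => v 0 i)) H : free (Tuple sP) by [].
case/negP: v0; apply/eqP/rowP => i; rewrite mxE; apply: H => {i}.
apply: (can_inj mxvecK); rewrite linear0 -vM linear_sum /=.
apply/rowP => j; rewrite summxE mxE; apply: eq_bigr => i _.
by rewrite linearZ /= !mxE.
Qed.

Lemma mxvec_dot (x y : 'M[F]_(n, d)) :
  (mxvec x *m (mxvec y)^T) 0 0 = \sum_i \sum_j x i j * y i j.
Proof.
rewrite mxE (reindex _ (curry_mxvec_bij _ _)) /= pair_bigA /=.
by apply: eq_bigr => -[i j] _; rewrite [_^T _ _]mxE !mxvecE.
Qed.

(** The square of the volume is a Gram determinant.  This leaves a sign
undetermined but needs no knowledge of the order in which [mxvec] lists the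
entries of a matrix. *)
Lemma basis_det_orthonormal xs :
  (forall i j, (i < n * d)%N -> (j < n * d)%N ->
     \sum_a \sum_b (nth 0 xs i : 'M_(n, d)) a b * (nth 0 xs j : 'M_(n, d)) a b
     = (i == j)%:R) ->
  exists s : bool, basis_det xs = (-1) ^+ s.
Proof.
move=> on; suff : basis_det xs * basis_det xs = 1.
  move=> /eqP; rewrite -expr2 sqrf_eq1 => /orP[]/eqP ->.
    by exists false.
  by exists true.
rewrite /basis_det -[X in _ * X]det_tr -det_mulmx -(det1 F (n * d)).
congr (\det _); apply/matrixP => i j; rewrite [RHS]mxE -(on _ _ (ltn_ord i) (ltn_ord j)).
by rewrite -mxvec_dot !mxE; apply: eq_bigr => k _; rewrite !mxE.
Qed.

End BasisDeterminants.

Lemma det33 (F : fieldType) (M : 'M[F]_3) : \det M =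
    M 0 0 * (M 1 1 * M 2%:R 2%:R - M 1 2%:R * M 2%:R 1)
  - M 0 1 * (M 1 0 * M 2%:R 2%:R - M 1 2%:R * M 2%:R 0)
  + M 0 2%:R * (M 1 0 * M 2%:R 1 - M 1 1 * M 2%:R 0).
Proof.
rewrite (expand_det_row M 0) !big_ord_recl big_ord0 /cofactor !det22 !mxE.
have e00 : lift 0 0 = 1 :> 'I_3 by apply/val_inj.
have e01 : lift 0 1 = 2%:R :> 'I_3 by apply/val_inj.
have -> : lift 0 (lift 0 0) = 2%:R :> 'I_3 by apply/val_inj.
rewrite e00 e01.
have -> : lift 1 0 = 0 :> 'I_3 by apply/val_inj.
have -> : lift 1 1 = 2%:R :> 'I_3 by apply/val_inj.
have -> : lift 2%:R 0 = 0 :> 'I_3 by apply/val_inj.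
have -> : lift 2%:R 1 = 1 :> 'I_3 by apply/val_inj.
rewrite !expr0 expr1 sqrrN expr1n; ring.
Qed.

Definition vec3 (F : fieldType) (a b c : F) : 'rV[F]_3 :=
  \row_j nth 0 [:: a; b; c] j.

Lemma vec3E (F : fieldType) (a b c : F) : (vec3 a b c 0 0 = a) *
  (vec3 a b c 0 1 = b) * (vec3 a b c 0 2%:R = c).
Proof. by rewrite /vec3 !mxE. Qed.

Lemma det33_functionals (F : fieldType) (V : nmodType) (f g k : V -> F) (a b c : V) :
  \det (\matrix_(i < 3) let x := nth 0 [:: a; b; c] i in
           vec3 (f x) (g x) (k x)) =
    f a * (g b * k c - k b * g c) - g a * (f b * k c - k b * f c)
  + k a * (f b * g c - g b * f c).
Proof. by rewrite det33 !mxE. Qed.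

Section TorsionByFunctionals.
Variables (F : fieldType) (act : letter -> 'rV[F]_3 -> 'rV[F]_3) (r : word).
Local Notation d0 := (delta0 act).
Local Notation d1 := (delta1 act r).
Local Notation C1 := 'M[F]_(2, 3).
Local Notation C2 := 'rV[F]_3.

Variables (h1 : C1) (h2 : C2).
Local Notation h := (GradedSeq [::] [:: h1] [:: h2]).
Hypothesis hh : cohomology_basis act r h.

Lemma cohomology_dims :
  [/\ \dim (lker d0) = 0%N, \dim (limg d0) = 3%N, d1 h1 = 0,
      \dim (lker d1) = 4%N & \dim (limg d1) = 2%N].
Proof.
move: hh; rewrite /cohomology_basis /quotient_basis => /and3P[].
move=> /= /andP[_ /eqP k0] /andP[/eqP h1E /eqP k1] /andP[_ /eqP k2].
have n0 := limg_ker_dim d0 fullv; have n1 := limg_ker_dim d1 fullv.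
rewrite !capfv !dimvf in n0 n1; rewrite dimvf in k2; rewrite dimv0 in k0.
have e1 : dim 'M[F]_(1, 3) = 3%N by rewrite dim_matrix.
have e2 : dim 'M[F]_(2, 3) = 6%N by rewrite dim_matrix.
rewrite e1 in n0 k2; rewrite e2 in n1.
split; [lia | lia | | lia | lia].
apply/eqP; rewrite -memv_ker -h1E; apply: (subvP (addvSr _ _)).
by rewrite memv_span // mem_head.
Qed.

(** The twisted Betti numbers are 0, 1, 1. *)
Lemma turaev_exponentE : turaev_exponent act r = 33%N.
Proof.
have [k0 i0 _ k1 i1] := cohomology_dims.
by rewrite /turaev_exponent /betti0 /betti1 /betti2 k0 i0 k1 i1.
Qed.

Variable b : graded_seq F 3.
Hypothesis hb : coboundary_lift act r b.

Lemma lift_shape : [/\ size (deg0 b) = 3%N, free (deg0 b),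
  exists b1 b2, deg1 b = [:: b1; b2] & deg2 b = [::]].
Proof.
have [k0 i0 _ k1 i1] := cohomology_dims.
move: hb; rewrite /coboundary_lift => /and3P[B0 B1 /nilP B2].
have s0 : size (deg0 b) = 3%N.
  by rewrite -(size_map d0) -(size_basis (X := in_tuple _) B0).
split=> //.
  have le1 := dim_span (deg0 b); have le2 := limg_ker_dim d0 <<deg0 b>>.
  rewrite limg_span (span_basis B0) in le2.
  rewrite /free eqn_leq le1 /=; apply: (@leq_trans (\dim (limg d0))).
    by rewrite i0 s0.
  by rewrite -le2 leq_addl.
have : size (deg1 b) = 2%N.
  by rewrite -(size_map d1) -(size_basis (X := in_tuple _) B1).
by case: (deg1 b) => [|x [|y [|z s]]] //; exists x, y.
Qed.

Lemma deg2_free : free (map d1 (deg1 b) ++ [:: h2]).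
Proof.
have [k0 i0 _ k1 i1] := cohomology_dims.
move: hb; rewrite /coboundary_lift => /and3P[_ B1 _].
move: hh; rewrite /cohomology_basis /quotient_basis => /and3P[_ _ /andP[/eqP h2E _]].
rewrite /free span_cat (span_basis B1) h2E dimvf size_cat size_map.
rewrite -(size_map d1) -(size_basis (X := in_tuple _) B1) i1.
by rewrite dim_matrix.
Qed.

Definition cochain2 (x y : 'rV[F]_3) : C1 :=
  \matrix_(i, j) (if i == 0 then x 0 j else y 0 j).

Local Notation e1 := (vec3 1 0 0).
Local Notation e2 := (vec3 0 1 0).
Local Notation e3 := (vec3 0 0 1).

Definition unit_cochains0 : seq C2 := [:: e1; e2; e3].
(** In this order the first three are dual to [coord1], and the functionals of
[psi_d1] are triangular on the last three. *)
Definition unit_cochains1 : seq C1 := [:: cochain2 e1 0; cochain2 e3 0;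
  cochain2 0 e1; cochain2 e2 0; cochain2 0 e2; cochain2 0 e3].

Lemma basis_det_unit_cochains0 : exists s : bool,
  basis_det unit_cochains0 = (-1) ^+ s.
Proof.
apply: basis_det_orthonormal => i j.
by case: i => [|[|[|//]]] _; case: j => [|[|[|//]]] _;
  rewrite /= big_ord1 !big_ord_recl big_ord0 !mxE /=; ring.
Qed.

Lemma basis_det_unit_cochains1 : exists s : bool,
  basis_det unit_cochains1 = (-1) ^+ s.
Proof.
apply: basis_det_orthonormal => i j.
by case: i => [|[|[|[|[|[|//]]]]]] _; case: j => [|[|[|[|[|[|//]]]]]] _;
  rewrite /= !big_ord_recl !big_ord0 !mxE /= ?mxE /=; ring.
Qed.

Lemma vec3_linear (V : lmodType F) (f g k : V -> F) : scalar f -> scalar g ->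
  scalar k -> linear (fun x => vec3 (f x) (g x) (k x)).
Proof.
move=> fl gl kl a x y; rewrite fl gl kl.
by apply: row3P; rewrite !(vec3E, mxE) /= ?mxE /=.
Qed.

Variables (phi1 : C1 -> F) (psi1 psi2 phi2 : C2 -> F).
Hypotheses (phi1_lin : scalar phi1) (psi1_lin : scalar psi1)
  (psi2_lin : scalar psi2) (phi2_lin : scalar phi2).
Hypothesis d10 : forall x, d1 (d0 x) = 0.
Hypothesis phi1_d0 : forall x, phi1 (d0 x) = 0.
Hypothesis phi2_d1 : forall x, phi2 (d1 x) = 0.

Definition coord1 (x : C1) : 'rV[F]_3 := vec3 (x 0 0) (x 0 2%:R) (x 1 0).
Definition psi_d1 (x : C1) : 'rV[F]_3 := vec3 (phi1 x) (psi1 (d1 x)) (psi2 (d1 x)).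
Definition chi2 (y : C2) : 'rV[F]_3 := vec3 (psi1 y) (psi2 y) (phi2 y).

Lemma coord1_linear : linear coord1.
Proof. by apply: vec3_linear => a x y; rewrite !mxE. Qed.

Lemma psi_d1_linear : linear psi_d1.
Proof.
apply: vec3_linear => // a x y; first by rewrite linearP psi1_lin.
by rewrite linearP psi2_lin.
Qed.

(** Pairing with [coord1] and [psi_d1] makes the basis in degree one block
triangular, because [psi_d1] vanishes on coboundaries.  The first block carries
the volume of the lifts of degree zero, and the second one the Gram determinant
[gram] of the lifts of degree one, which also occurs in degree two; both volumes
cancel in the torsion. *)
Lemma torsion_functionals :
  phi1 h1 = 1 -> phi1 (cochain2 0 e2) = 0 -> phi1 (cochain2 0 e3) = 0 ->
  psi1 (d1 (cochain2 0 e3)) = 0 ->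
  \det (\matrix_(i < 3) coord1 (d0 (nth 0 unit_cochains0 i))) != 0 ->
  \det (\matrix_(i < 3) chi2 (nth 0 unit_cochains0 i)) != 0 ->
  torsion act r b h *
    (\det (\matrix_(i < 3) coord1 (d0 (nth 0 unit_cochains0 i))) *
     \det (\matrix_(i < 3) chi2 (nth 0 unit_cochains0 i))) =
  basis_det unit_cochains1 * (phi1 (cochain2 e2 0) * psi1 (d1 (cochain2 0 e2)) *
    psi2 (d1 (cochain2 0 e3))) * phi2 h2.
Proof.
move=> phi1h phi12 phi13 psi13 D0 T0.
have [b0_size b0_free [b1 [b2 b1E]] b2E] := lift_shape.
have [_ _ h1_cocycle _ _] := cohomology_dims.
have [s0 sE0] := basis_det_unit_cochains0.
have [s1 sE1] := basis_det_unit_cochains1.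
rewrite /torsion b1E b2E /=.
set X1 := basis_det (map d0 _ ++ _); set X2 := basis_det (_ :: _).
set beta := basis_det (deg0 b).
set gram := psi1 (d1 b1) * psi2 (d1 b2) - psi2 (d1 b1) * psi1 (d1 b2).
have beta0 : beta != 0 by apply: basis_det_free; rewrite ?b0_size.
have X20 : X2 != 0.
  by have := deg2_free; rewrite b1E /= => ?; apply: basis_det_free.
set D := \det (\matrix_i coord1 _) in D0 *; set T := \det (\matrix_i chi2 _) in T0 *.
set Delta := \det (\matrix_(i < 3) coord1 (d0 (nth 0 (deg0 b) i))).
have betaD : beta * D = (-1) ^+ s0 * Delta.
  rewrite -sE0; apply: (@basis_det_change F 1 3 (fun x => coord1 (d0 x))).
  by move=> a x y; rewrite linearP coord1_linear.
have X2T : X2 * T = (-1) ^+ s0 * (gram * phi2 h2).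
  rewrite -sE0 (@basis_det_change F 1 3 chi2); last exact: vec3_linear.
  congr (_ * _); rewrite det33 ![(\matrix_i _) _ _]mxE /= /chi2 !vec3E !phi2_d1 /gram.
  by ring.
have X1A : X1 * (phi1 (cochain2 e2 0) * psi1 (d1 (cochain2 0 e2)) *
    psi2 (d1 (cochain2 0 e3))) = (-1) ^+ s1 * (Delta * gram).
  pose f (x : C1) : 'rV[F]_(3 + 3) := row_mx (coord1 x) (psi_d1 x).
  have flin : linear (fun x => row_mx (coord1 x) (psi_d1 x)).
    move=> a x y; rewrite coord1_linear psi_d1_linear.
    by rewrite scale_row_mx add_row_mx.
  have fL x j : f x 0 (lshift 3 j) = coord1 x 0 j by rewrite /f row_mxEl.
  have fR x j : f x 0 (rshift 3 j) = psi_d1 x 0 j by rewrite /f row_mxEr.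
  pose M xs : 'M[F]_(3 + 3) := \matrix_(i < 3 + 3) f (nth 0 xs i).
  have fM xs i j : M xs i j = f (nth 0 xs i) 0 j by rewrite mxE.
  have ulE (N : 'M[F]_(3 + 3)) i j : ulsubmx N i j = N (lshift 3 i) (lshift 3 j).
    by rewrite -{2}(submxK N) block_mxEul.
  have urE (N : 'M[F]_(3 + 3)) i j : ursubmx N i j = N (lshift 3 i) (rshift 3 j).
    by rewrite -{2}(submxK N) block_mxEur.
  have dlE (N : 'M[F]_(3 + 3)) i j : dlsubmx N i j = N (rshift 3 i) (lshift 3 j).
    by rewrite -{2}(submxK N) block_mxEdl.
  have drE (N : 'M[F]_(3 + 3)) i j : drsubmx N i j = N (rshift 3 i) (rshift 3 j).
    by rewrite -{2}(submxK N) block_mxEdr.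
  have psi10 : psi1 0 = 0.
    by have := psi1_lin (-1) 0 0; rewrite scaleN1r addNr mulN1r addNr.
  have psi20 : psi2 0 = 0.
    by have := psi2_lin (-1) 0 0; rewrite scaleN1r addNr mulN1r addNr.
  have : X1 * \det (M unit_cochains1) = basis_det unit_cochains1 * \det (M _) :=
    @basis_det_change F 2 3 f (map d0 (deg0 b) ++ [:: h1; b1; b2]) _ flin.
  rewrite sE1.
  have -> : \det (M unit_cochains1) =
    phi1 (cochain2 e2 0) * psi1 (d1 (cochain2 0 e2)) * psi2 (d1 (cochain2 0 e3)).
    rewrite -(submxK (M _)).
    have -> : dlsubmx (M unit_cochains1) = 0.
      apply/matrixP => i j; rewrite dlE fM fL [RHS]mxE.
      by case: i => [[|[|[|//]]] ?]; case: j => [[|[|[|//]]] ?]; rewrite !mxE.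
    rewrite det_ublock.
    have -> : ulsubmx (M unit_cochains1) = 1.
      apply/matrixP => i j; rewrite ulE fM fL [RHS]mxE.
      by case: i => [[|[|[|//]]] ?]; case: j => [[|[|[|//]]] ?]; rewrite !mxE.
    rewrite det1 mul1r det33 !drE !fM !fR /= /psi_d1 !vec3E phi12 phi13 psi13.
    by ring.
  move=> ->; congr (_ * _).
  rewrite -(submxK (M _)).
  have -> : ursubmx (M (map d0 (deg0 b) ++ [:: h1; b1; b2])) = 0.
    apply/matrixP => i j; rewrite urE fM fR [RHS]mxE /= nth_cat size_map b0_size.
    rewrite ltn_ord (nth_map 0) ?b0_size // /psi_d1 d10 phi1_d0 psi10 psi20.
    by case: j => [[|[|[|//]]] ?]; rewrite !mxE.
  rewrite det_lblock; congr (_ * _).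
    congr (\det _); apply/matrixP => i j; rewrite ulE fM fL [RHS]mxE /= nth_cat.
    by rewrite size_map b0_size ltn_ord (nth_map 0) ?b0_size.
  have drM i j : drsubmx (M (map d0 (deg0 b) ++ [:: h1; b1; b2])) i j =
      psi_d1 (nth 0 [:: h1; b1; b2] i) 0 j.
    rewrite drE fM fR /= nth_cat size_map b0_size.
    by rewrite ltnNge leq_addr /= addKn.
  rewrite det33 !drM /= /psi_d1 !vec3E phi1h h1_cocycle psi10 psi20 /gram.
  by ring.
have gram0 : gram * phi2 h2 != 0.
  have : X2 * T != 0 by rewrite mulf_neq0.
  by rewrite X2T mulf_eq0 negb_or => /andP[].
have Delta0 : Delta != 0.
  have : beta * D != 0 by rewrite mulf_neq0.
  by rewrite betaD mulf_eq0 negb_or => /andP[].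
move: gram0; rewrite mulf_eq0 negb_or => /andP[gram0 _].
have X10 : X1 != 0.
  apply/eqP => X10; move: X1A; rewrite X10 mul0r => /esym/eqP.
  by rewrite !mulf_eq0 signr_eq0 (negPf gram0) (negPf Delta0).
apply: (mulfI X10); rewrite -/X2.
set A := phi1 _ * _ * _ in X1A *.
have -> : X1 * (beta * X1^-1 * X2 * (D * T)) = (beta * D) * (X2 * T) by field.
have -> : X1 * (basis_det unit_cochains1 * A * phi2 h2) =
  (X1 * A) * basis_det unit_cochains1 * phi2 h2 by ring.
rewrite X1A X2T betaD sE1.
have ss s : (-1 : F) ^+ s * (-1) ^+ s = 1 by rewrite -expr2 sqrr_sign.
transitivity (((-1) ^+ s0 * (-1) ^+ s0) * (Delta * gram * phi2 h2)); first by ring.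
transitivity (((-1) ^+ s1 * (-1) ^+ s1) * (Delta * gram * phi2 h2)); last by ring.
by rewrite !ss.
Qed.

End TorsionByFunctionals.

(** * The sign of the torsion with trivial coefficients *)

Section TrivialCoefficients.
Variable F : fieldType.
Variable w : word.
Local Notation r := (w ++ [:: g1] ++ winv w ++ [:: linv g2]).
Local Notation act := (@trivial_act F).
Local Notation d0 := (delta0 act).
Local Notation d1 := (delta1 act r).

Let act_lin l : linear (act l). Proof. by []. Qed.

Let actK l x : act l (act (linv l) x) = x. Proof. by []. Qed.

Lemma trivial_wact g x : wact act g x = x.
Proof. by elim: g => //= l g ->. Qed.

Lemma trivial_delta0 x : d0 x = 0.
Proof. by apply/row_matrixP => i; rewrite row_delta0 // subrr row0. Qed.

Lemma trivial_delta1 x : d1 x 0 0 = x 0 0 - x 1 0.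
Proof.
rewrite delta1E // on_path_conj_relator //; last by move=> y; rewrite trivial_wact.
by rewrite trivial_wact {2}/trivial_act; move: (on_path _ _ _) => y; rewrite !mxE; ring.
Qed.

Lemma trivial_dims :
  [/\ \dim (limg d0) = 0%N, \dim (limg d1) = 1%N, \dim (lker d0) = 1%N
    & \dim (lker d1) = 1%N].
Proof.
have i0 : \dim (limg d0) = 0%N.
  apply/eqP; rewrite dimv_eq0 -subv0; apply/subvP => y /memv_imgP[x _ ->].
  by rewrite trivial_delta0 mem0v.
have n0 := limg_ker_dim d0 fullv; have n1 := limg_ker_dim d1 fullv.
rewrite !capfv !dimvf in n0 n1.
have e1 : dim 'M[F]_(1, 1) = 1%N by rewrite dim_matrix.
have e2 : dim 'M[F]_(2, 1) = 2%N by rewrite dim_matrix.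
rewrite e1 in n0; rewrite e2 in n1.
have i1 : \dim (limg d1) = 1%N.
  have le1 : (\dim (limg d1) <= 1)%N.
    by apply: leq_trans (dimvS (subvf _)) _; rewrite dimvf e1.
  apply/eqP; rewrite eqn_leq le1 /=.
  rewrite lt0n dimv_eq0; apply/eqP => i0'.
  have : d1 (delta_mx 0 0) \in limg d1 by rewrite memv_img ?memvf.
  rewrite i0' memv0 => /eqP/matrixP/(_ 0 0); rewrite trivial_delta1 !mxE /=.
  by move/eqP; rewrite subr0 oner_eq0.
by split=> //; lia.
Qed.

(** The first coboundary map is zero and the second one is the difference of the
values on the two generators.  The lift in degree one therefore contributes its
coboundary to degree two and, up to a factor from the cohomology class, the same
number to degree one. *)
Lemma trivial_torsion h : cohomology_basis act r h ->
  exists2 t : F, t != 0 &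
    forall b, coboundary_lift act r b -> torsion act r b h = t.
Proof.
have [i0 i1 k0 k1] := trivial_dims.
rewrite /cohomology_basis /quotient_basis => /and3P[].
rewrite k0 k1 i0 i1 dimvf dimv0 !add0n.
move=> /andP[/eqP h0E /eqP s0] /andP[/eqP h1E /eqP s1] /andP[_ /eqP s2].
have {}s2 : size (deg2 h) = 0%N by move: s2; rewrite dim_matrix; case: (size _).
case: h s0 s1 s2 h0E h1E => -[|x []] //= -[|z []] //= -[] // _ _ _ h0E h1E.
have x0 : x 0 0 != 0.
  apply/eqP => x0; have x0' : x = 0 by apply/matrixP => i j; rewrite !ord1 x0 mxE.
  by move: k0; rewrite -h0E x0' add0v span_seq1 dim_vline eqxx.
have zker : d1 z = 0.
  apply/eqP; rewrite -memv_ker -h1E; apply: (subvP (addvSr _ _)).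
  by rewrite memv_span // mem_head.
have z01 : z 0 0 = z 1 0.
  by apply/eqP; rewrite -subr_eq0 -trivial_delta1 zker mxE.
have z0 : z 0 0 != 0.
  apply/eqP => z0; have z0' : z = 0.
    apply/matrixP => i j; rewrite !ord1 [RHS]mxE.
    by case: (ord2_cases i) => ->; rewrite -?z01.
  move: k1; rewrite -h1E z0' span_seq1.
  have -> : limg d0 = 0%VS by apply/eqP; rewrite -dimv_eq0 i0.
  by rewrite add0v dim_vline eqxx.
pose es : seq 'M[F]_(2, 1) := [:: delta_mx 0 0; delta_mx 1 0].
have [s sE] : exists s : bool, basis_det es = (-1) ^+ s.
  apply: basis_det_orthonormal => i j.
  by case: i => [|[|//]] _; case: j => [|[|//]] _;
    rewrite /= !big_ord_recl !big_ord0 !mxE /=; ring.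
have det2E (y : 'M[F]_(2, 1)) :
    basis_det [:: z; y] = (-1) ^+ s * (z 0 0 * (y 1 0 - y 0 0)).
  pose f (v : 'M[F]_(2, 1)) : 'rV[F]_(2 * 1) := v^T.
  have flin : linear f by move=> a u v; rewrite /f linearP.
  pose M xs : 'M[F]_2 := \matrix_(i < 2 * 1) f (nth 0 xs i).
  have : basis_det [:: z; y] * \det (M es) = basis_det es * \det (M _) :=
    @basis_det_change F 2 1 f _ _ flin.
  have -> : \det (M es) = 1 by rewrite det22 !mxE /=; ring.
  rewrite mulr1 sE => ->; congr (_ * _).
  by rewrite det22 !mxE /= z01; ring.
exists (x 0 0 * ((-1) ^+ s * - z 0 0)^-1).
  by rewrite mulf_neq0 // invr_neq0 // mulf_neq0 ?signr_eq0 // oppr_eq0.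
move=> b; rewrite /coboundary_lift => /and3P[B0 B1 /nilP B2].
have sz0 : size (deg0 b) = 0%N.
  by rewrite -(size_map d0) -(size_basis (X := in_tuple _) B0).
have sz1 : size (deg1 b) = 1%N.
  by rewrite -(size_map d1) -(size_basis (X := in_tuple _) B1).
case: b B0 B1 B2 sz0 sz1 => -[|//] -[|y []] //= b2 B0 B1 B2 _ _.
rewrite /torsion /= B2 det2E.
have det1 (v : 'M[F]_1) : basis_det [:: v] = v 0 0.
  pose M : 'M[F]_1 := \matrix_(i < 1 * 1) mxvec (nth 0 [:: v] i).
  rewrite -[LHS]/(\det M) det_mx11 -(mxvecE v 0 0) mxE /=.
  by congr (mxvec _ _ _); rewrite [RHS]ord1.
have y0 : d1 y 0 0 != 0.
  apply/eqP => y0; have y0' : d1 y = 0 by apply/matrixP => i j; rewrite !ord1 y0 mxE.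
  by move: (basis_free B1); rewrite y0' /free span_seq1 dim_vline eqxx.
rewrite !det1 -mulrA; congr (_ * _); rewrite trivial_delta1 in y0 *.
have -> : y 1 0 - y 0 0 = - (y 0 0 - y 1 0) by ring.
have s0 : (-1 : F) ^+ s != 0 by rewrite signr_eq0.
move: (y 0 0 - y 1 0) y0 => e e0.
by field; rewrite !oppr_eq0 s0 z0 e0.
Qed.

End TrivialCoefficients.

Lemma trivial_torsion_sign (R : realType) p q hR :
  cohomology_basis (@trivial_act R) (relator p q) hR ->
  exists s : bool, forall bR,
    coboundary_lift (@trivial_act R) (relator p q) bR ->
    Num.sg ((-1) ^+ turaev_exponent (@trivial_act R) (relator p q)
            * torsion (@trivial_act R) (relator p q) bR hR) = (-1) ^+ s.
Proof.
move=> /trivial_torsion[t t0 tE].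
exists (odd (turaev_exponent (@trivial_act R) (relator p q)) (+) (t < 0)) => bR /tE ->.
rewrite sgrM sgrX sgrN1 signr_addb signr_odd; congr (_ * _).
by case: sgrP t0 => //; rewrite ?eqxx // => ?; rewrite ?ltNge ?ltW.
Qed.

(** * The axes of the two generators *)

(** As [killing z] vanishes on [x], which is not zero, and not on [y], the two
span a plane, and only scalars centralize a plane of sl_2. *)
Lemma centralizer_scalar (K : numFieldType) (C : 'M[K]_2) (x y z : 'rV[K]_3) :
  C * sl2_mx x = sl2_mx x * C -> C * sl2_mx y = sl2_mx y * C ->
  x 0 0 != 0 -> killing z x = 0 -> killing z y != 0 -> C = (C 0 0)%:M.
Proof.
move=> /matrixP Cx /matrixP Cy x0 zx zy.
have := Cx 0 0; have := Cx 0 1; have := Cy 0 0; have := Cy 0 1.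
rewrite !mul22E !sl2_mxE => y01 y00 x01 x00.
have [b0|b0] := eqVneq (C 0 1) 0.
  have c0 : C 1 0 = 0.
    apply: (mulfI x0); rewrite mulr0 -(addrK (x 0 1 * C 0 0) (_ * C 1 0)).
    by rewrite [_ * C 1 0 + _]addrC -x00 b0; ring.
  have dE : C 1 1 = C 0 0.
    apply: (mulfI x0); rewrite -(addKr (x 0 1 * C 0 1) (_ * C 1 1)) -x01 b0.
    by ring.
  by apply: mx2P; rewrite !mxE /= ?b0 ?c0 ?dE.
case/eqP: zy; have n2 : (2%:R : K) != 0 by rewrite pnatr_eq0.
have ad (v : 'rV[K]_3) : C 0 0 * v 0 0 + C 0 1 * - v 0 1 = v 0 1 * C 0 1 + v 0 0 * C 1 1 ->
    2%:R * C 0 1 * v 0 1 = (C 0 0 - C 1 1) * v 0 0 :> K.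
  move=> vE; transitivity (v 0 1 * C 0 1 + v 0 0 * C 1 1 + C 0 1 * v 0 1 - v 0 0 * C 1 1).
    by ring.
  by rewrite -vE; ring.
have y1E : y 0 1 = y 0 0 / x 0 0 * x 0 1.
  apply: (mulfI (mulf_neq0 n2 b0)); rewrite (ad _ y01).
  transitivity (y 0 0 / x 0 0 * (2%:R * C 0 1 * x 0 1)); last by ring.
  by rewrite (ad _ x01); field.
have bc (v : 'rV[K]_3) : C 0 0 * v 0 1 + C 0 1 * v 0 2%:R = v 0 1 * C 0 0 + v 0 0 * C 1 0 ->
    C 0 1 * v 0 2%:R = v 0 0 * C 1 0 :> K.
  move=> vE; transitivity (C 0 0 * v 0 1 + C 0 1 * v 0 2%:R - C 0 0 * v 0 1).
    by ring.
  by rewrite vE; ring.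
have y2E : y 0 2%:R = y 0 0 / x 0 0 * x 0 2%:R.
  apply: (mulfI b0); rewrite (bc _ y00).
  transitivity (y 0 0 / x 0 0 * (C 0 1 * x 0 2%:R)); last by ring.
  by rewrite (bc _ x00); field.
have -> : killing z y = y 0 0 / x 0 0 * killing z x.
  by rewrite /killing y1E y2E; field.
by rewrite zx mulr0.
Qed.

Section RileyTorsion.
Variables (K : numFieldType) (m u : K).
Hypotheses (m0 : m != 0) (m1 : m ^+ 2 != 1).
Local Notation rho := (riley m u).
Local Notation act := (Ad (riley m u)).

Let detr := det_riley u m0.
Let actl := @Ad_linear K rho detr.
Let actK := AdK detr.

Local Notation delta := (m - m^-1).

Lemma delta_neq0 : delta != 0.
Proof.
apply: contra m1 => /eqP d0; apply/eqP.
have -> : m ^+ 2 = m * delta + 1 by field.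
by rewrite d0 mulr0 add0r.
Qed.

Lemma Ad_g1E a b c : act g1 (vec3 a b c) =
  vec3 (m ^+ 2 * a - 2%:R * m * b - c) (b + c / m) (c / m ^+ 2).
Proof.
apply: sl2_mx_inj; rewrite (sl2_Ad detr) rho_letter_riley //= inv22; last first.
  by rewrite det22 !mx22E; field.
rewrite /sl2_mx !vec3E !mx22E !mx22M.
by apply: mx2P; rewrite !mx22E; field.
Qed.

Lemma Ad_g2E a b c : act g2 (vec3 a b c) =
  vec3 (m ^+ 2 * a) (b + m * u * a) (c / m ^+ 2 - 2%:R * u * b / m - u ^+ 2 * a).
Proof.
apply: sl2_mx_inj; rewrite (sl2_Ad detr) rho_letter_riley //= inv22; last first.
  by rewrite det22 !mx22E; field.
rewrite /sl2_mx !vec3E !mx22E !mx22M.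
by apply: mx2P; rewrite !mx22E; field.
Qed.

(** These are [A - A^-1] and [B - B^-1], for the images [A] and [B] of the
generators; by the theorem of Cayley and Hamilton they differ from [2 A] and
[2 B] by the same scalar. *)
Definition axis1 : 'rV[K]_3 := vec3 2%:R delta 0.
Definition axis2 : 'rV[K]_3 := vec3 0 delta (- (2%:R * u)).

Lemma sl2_axis1 : sl2_mx axis1 = rho 0 *+ 2 - (m + m^-1)%:M.
Proof. by rewrite /riley /=; apply: mx2P; rewrite sl2_mxE !vec3E mulr2n !mxE /=; field. Qed.

Lemma sl2_axis2 : sl2_mx axis2 = rho 1 *+ 2 - (m + m^-1)%:M.
Proof. by rewrite /riley /=; apply: mx2P; rewrite sl2_mxE !vec3E mulr2n !mxE /=; field. Qed.

Lemma Ad_axis1 : act g1 axis1 = axis1.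
Proof. by rewrite Ad_g1E; apply: row3P; rewrite !vec3E; field. Qed.

Lemma Ad_axis2 : act g2 axis2 = axis2.
Proof. by rewrite Ad_g2E; apply: row3P; rewrite !vec3E; field. Qed.

Lemma Ad_g1_invariant P : act g1 P = P -> P = (P 0 0 / 2%:R) *: axis1.
Proof.
have n2 : (2%:R : K) != 0 by rewrite pnatr_eq0.
have PE : P = vec3 (P 0 0) (P 0 1) (P 0 2%:R) by apply: row3P; rewrite vec3E.
rewrite {1 2}PE Ad_g1E => /rowP E.
have := E 0; have := E 1; rewrite !vec3E => E1 E0.
have P2 : P 0 2%:R = 0.
  apply: (mulIf (invr_neq0 m0)); rewrite mul0r; apply/eqP.
  by move/eqP: E1; rewrite -subr_eq0 addrAC subrr add0r.
have P1 : 2%:R * P 0 1 = delta * P 0 0.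
  apply: (mulfI m0); apply/eqP; rewrite -subr_eq0; apply/eqP.
  rewrite P2 in E0.
  transitivity (- (m ^+ 2 * P 0 0 - 2%:R * m * P 0 1 - 0 - P 0 0)); first by field.
  by rewrite E0 subrr oppr0.
apply: row3P; rewrite !mxE /=.
- by rewrite mulfVK.
- by rewrite mulrAC [P 0 0 * _]mulrC -P1 mulrAC mulfV // mul1r.
- by rewrite P2 mulr0.
Qed.

Lemma conj_axis g a b : rho_word rho g * rho a = rho b * rho_word rho g ->
  rho_word rho g * (rho a *+ 2 - (m + m^-1)%:M) * (rho_word rho g)^-1 =
  rho b *+ 2 - (m + m^-1)%:M.
Proof.
move=> gab; have ug := unit_rho_word detr g.
rewrite mulrBr mulrnAr gab -mulrnAl.
have -> : rho_word rho g * (m + m^-1)%:M = (m + m^-1)%:M * rho_word rho g.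
  by rewrite -[LHS]/(_ *m _) -[RHS]/(_ *m _) scalar_mxC.
by rewrite -mulrBl mulrK.
Qed.

(** The source of the factor [v_11 phi_v] of the torsion. *)
Lemma axis1_conj_entry g : wact act g axis1 0 0 =
  2%:R * (rho_word rho g 0 0 * phi g m u).
Proof.
rewrite -[wact _ _ _](@sl2_mxK K) sl2_coordE (sl2_wact detr) inv22 ?det_rho_word //.
rewrite /phi; move: (rho_word rho g) => V.
by rewrite !mul22E !mx22E /axis1 !vec3E; ring.
Qed.

End RileyTorsion.

(** * The torsion of a two-bridge knot *)

Section TwoBridgeTorsion.
Variables (K : numFieldType) (p : nat) (q : int) (k : nat) (kappa : int).
Hypotheses (p_gt0 : (0 < p)%N) (p_odd : odd p) (q_odd : odd `|q|%N).
Hypotheses (pq_coprime : coprime p `|q|%N) (kp : (0 < k < p)%N).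
Hypothesis kappa1 : kappa = 1 \/ kappa = -1.
Hypothesis kq : (k%:Z * q = kappa %[mod p.*2%:Z])%Z.
Variables (m u : K) (h : word).
Hypotheses (m0 : m != 0) (m1 : m ^+ 2 != 1).
Local Notation w := (tb_word p q).
Local Notation v := (tb_prefix p q k.-1).
Local Notation r := (relator p q).
Local Notation rho := (riley m u).
Local Notation act := (Ad (riley m u)).
Local Notation delta := (m - m^-1).
Hypothesis phi_w : phi w m u = 0.
Hypothesis rho_r : rho_word rho r = 1.
Hypothesis dphi0 : dphi_du w m u != 0.
Hypothesis filling : torus_filling p q h.

Let detr := det_riley u m0.
Let actl := @Ad_linear K rho detr.
Let actK := AdK detr.
Let d0 := delta0 act.
Let d1 := delta1 act r.
Local Notation h0 := (symmetry_conjugator p q k kappa).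
Local Notation e2 := (vec3 0 1 0 : 'rV[K]_3).
Local Notation e3 := (vec3 0 0 1 : 'rV[K]_3).
Local Notation axis1 := (axis1 m).
Local Notation axis2 := (axis2 m u).

Lemma wact_trivial g : rho_word rho g = 1 -> forall y, wact act g y = y.
Proof.
move=> g1 y; apply: sl2_mx_inj.
by rewrite (sl2_wact detr) g1 invr1 mulr1 mul1r.
Qed.

Let r1 : forall y, wact act r y = y := wact_trivial rho_r.

Lemma tb_word_intertwines : rho_word rho w * rho 0 = rho 1 * rho_word rho w.
Proof.
apply/eqP; rewrite -subr_eq0 riley_defect //; last exact: rev_tb_word.
by rewrite phi_w scale0r.
Qed.

Lemma wact_tb_word_axis : wact act w axis1 = axis2.
Proof.
apply: sl2_mx_inj; rewrite (sl2_wact detr) (@sl2_axis1 K m u m0) sl2_axis2 //.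
exact/conj_axis/tb_word_intertwines.
Qed.

(** The representation is defined on the quotient by the relator, hence also kills
the conjugates of its inverse. *)
Lemma rho_swapw_relator : rho_word rho (swapw r) = 1.
Proof.
have uc := @unit_rho_word _ _ detr.
have rV : rho_word rho (winv r) = 1 by rewrite rho_word_winv // rho_r invr1.
have rot a c : rho_word rho (a ++ c) = 1 -> rho_word rho (c ++ a) = 1.
  rewrite !rho_word_cat => ac; apply: (mulrI (uc a)).
  by rewrite mulrA ac mul1r mulr1.
have [a [c [[-> rE _]|[-> rE _]]]] :=
  swapw_relator_conj p_gt0 p_odd q_odd pq_coprime kp kappa1 kq.
  by apply: rot; rewrite -rE.
by apply: rot; rewrite -rE.
Qed.

Lemma wact_rev_tb_word_axis : wact act (rev w) axis2 = axis1.
Proof.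
apply: sl2_mx_inj; rewrite (sl2_wact detr) (@sl2_axis1 K m u m0) sl2_axis2 //.
apply: conj_axis => //; have := rho_swapw_relator.
rewrite (swapw_relator p_gt0 p_odd q_odd pq_coprime).
rewrite !rho_word_cat !rho_word1 rho_word_winv // rho_letterV // /rho_letter /=.
have uU := unit_rho_word detr (rev w); have uA := unit22 (detr 0).
move: (rho_word _ _) uU => U uU E.
have <- : U * rho 1 * U^-1 = rho 0; last by rewrite mulrVK.
have uV : (rho 0)^-1 \is a GRing.unit by rewrite unitrV.
by apply: (mulIr uV); rewrite mulrV // -!mulrA.
Qed.

(** By [swapw_relator_conj] the relator with the generators exchanged bounds the
translate by [h0] of the 2-cell, with the opposite orientation. *)
Lemma on_path_swapw_relator x :
  on_path act x (swapw r) = - wact act h0 (on_path act x r).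
Proof.
have [a [c [[sE rE ->]|[sE rE ->]]]] :=
  swapw_relator_conj p_gt0 p_odd q_odd pq_coprime kp kappa1 kq.
  exact: on_path_rotV sE rE.
rewrite (on_path_rotV actl actK x r1 sE rE); congr (- _).
have ca y : wact act (c ++ a) y = y.
  by rewrite -rE -[in LHS](r1 y) wactKV.
by rewrite -[in RHS](ca (on_path act x r)) wact_cat wactKV.
Qed.

(** The meridian [g_2] cuts the torus into two annuli: inserting it and its
inverse into the commutator produces the relator and its image under the
exchange of the generators. *)
Lemma torus_square_equiv :
  path_equiv act (wcomm (lambda p q) mu)
    ((rev w ++ r ++ winv (rev w)) ++ swapw r).
Proof.
have refl g : path_equiv act g g by [].
rewrite (swapw_relator p_gt0 p_odd q_odd pq_coprime) /lambda.
set U := rev w; set l := lpow _ _.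
have -> : wcomm (U ++ w ++ l) mu =
    U ++ w ++ (l ++ [:: g1] ++ winv l) ++ (winv w ++ winv U ++ [:: linv g1]).
  by rewrite /wcomm !winv_cat -!catA.
apply: (@path_equiv_trans _ _ act
  (U ++ w ++ [:: g1] ++ (winv w ++ winv U ++ [:: linv g1]))).
  do 2![apply: path_equiv_cat => //]; apply: path_equiv_cat => //.
  exact: path_equiv_lpow.
have -> : (U ++ r ++ winv U) ++ U ++ [:: g2] ++ winv U ++ [:: linv g1] =
    U ++ w ++ [:: g1] ++ winv w ++
    ([:: linv g2] ++ (winv U ++ U) ++ [:: g2]) ++ (winv U ++ [:: linv g1]).
  by rewrite /relator -!catA.
do 4![apply: path_equiv_cat => //].
rewrite -[X in path_equiv _ X]cat0s; apply: path_equiv_cat => //.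
apply: path_equiv_sym.
apply: (@path_equiv_trans _ _ act ([:: linv g2] ++ [::] ++ [:: g2])).
  apply: path_equiv_cat => //; apply: path_equiv_cat => //.
  exact: path_equiv_Vcat.
exact: (path_equiv_Vcat actl actK [:: g2]).
Qed.

Lemma on_path_torus_square x : on_path act x (wcomm (lambda p q) mu) =
  wact act (rev w) (on_path act x r) - wact act h0 (on_path act x r).
Proof.
have [-> _] := torus_square_equiv.
by rewrite on_path_cat // on_path_conj // wact_cat wact_cat r1 wactVK //
   on_path_swapw_relator.
Qed.

(** Both [h] and [h0] describe the second annulus, so they translate the values
of coboundaries in the same way. *)
Lemma wact_filling x : wact act h (on_path act x r) = wact act h0 (on_path act x r).
Proof.
apply: (addrI (- wact act (rev w) (on_path act x r))); apply: oppr_inj.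
rewrite !opprD opprK -on_path_torus_square.
have /(on_path_free_eq actl actK x) -> := filling.
rewrite catA catA -(catA (rev w)) on_path_cat // on_path_conj //.
rewrite on_path_conj //; last by move=> y; rewrite -[in LHS](r1 y) wactKV.
rewrite wact_cat wact_cat r1 wactVK // on_path_winv // wactN //; congr (_ - _).
by congr (wact _ _ _); rewrite -[in RHS](r1 (on_path act x r)) wactKV.
Qed.

Lemma d1E x : d1 x = on_path act x w + wact act w (row 0 x)
                    - act g2 (on_path act x w) - row 1 x.
Proof. by rewrite /d1 delta1E // on_path_conj_relator. Qed.

Lemma d10 x : d1 (d0 x) = 0.
Proof.
by rewrite /d1 delta1E // on_path_delta0 // r1 subrr.
Qed.

(** The two terms that involve the value on [w] cancel, since [g_2] fixes its
axis. *)
Lemma killing_axis2_d1 x :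
  killing axis2 (d1 x) = killing axis1 (row 0 x) - killing axis2 (row 1 x).
Proof.
rewrite d1E !killingBr killingDr.
have -> : killing axis2 (wact act w (row 0 x)) = killing axis1 (row 0 x).
  by rewrite -wact_tb_word_axis killing_wact.
have -> : killing axis2 (act g2 (on_path act x w)) = killing axis2 (on_path act x w).
  by apply: (@killing_wact_id _ rho [:: g2]) => //; exact: Ad_axis2.
by ring.
Qed.

Local Notation dphi := (dphi_du w m u).

(** This cochain is [- m] times the one tangent to the deformation in [u].  The
coboundary of the latter has upper right entry [(1 - m^2) s] for [s] the upper right entry of
its value on [w], while [phi_w = 0] and [det W = 1] turn the derivative of
[phi_w] into a multiple of [s] as well. *)
Lemma d1_e3_entry : d1 (cochain2 0 e3) 0 0 = - (m ^+ 2 * rho_word rho w 0 0 * dphi).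
Proof.
have -> : cochain2 0 e3 = - m *: du_cochain m.
  apply/matrixP => i j; rewrite !mxE.
  case: (ord2_cases i) => -> /=; first by rewrite ?mxE mulr0.
  by case: j => [[|[|[|//]]] ?]; rewrite /= ?mulr0 // mulrNN mulfV.
have sclE a (x : 'rV[K]_3) : (a *: x) 0 0 = a * x 0 0 by rewrite mxE.
rewrite linearZ /= sclE.
have addE (x y : 'rV[K]_3) : (x + y) 0 0 = x 0 0 + y 0 0 by rewrite mxE.
have oppE (x : 'rV[K]_3) : (- x) 0 0 = - x 0 0 by rewrite mxE.
rewrite d1E !addE !oppE du_cochain_row0.
have -> : wact act w (0 : 'rV_3) = 0.
  by have := wactB actl w 0 0; rewrite !subrr.
rewrite dphi_duE // -/(dphi_du w m u).
set S := on_path act _ w; set W := rho_word rho w.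
have SE : S = vec3 (S 0 0) (S 0 1) (S 0 2%:R) by apply: row3P; rewrite vec3E.
have -> : act g2 S 0 0 = m ^+ 2 * S 0 0 by rewrite {1}SE Ad_g2E // vec3E.
rewrite !mul22E !sl2_mxE.
have -> : row 1 (du_cochain m) 0 0 = 0 by rewrite !mxE.
have W1 : W 0 0 * W 1 1 - W 0 1 * W 1 0 = 1 by rewrite -det22 det_rho_word.
have W00 : W 0 0 = delta * W 0 1 by apply/eqP; rewrite -subr_eq0 -phi_w.
have -> : (0 : 'rV[K]_3) 0 0 = 0 by rewrite mxE.
transitivity (- (m ^+ 2 * delta * (S 0 0 * - 1))); first by field.
rewrite -W1 W00; ring.
Qed.

Lemma killing_axis2_d1_e2 : killing axis2 (d1 (cochain2 0 e2)) = - (8%:R * delta).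
Proof.
rewrite killing_axis2_d1.
have -> : row 0 (cochain2 0 e2) = 0 by apply/rowP => j; rewrite !mxE.
have -> : row 1 (cochain2 0 e2) = e2 by apply/rowP => j; rewrite !mxE.
by rewrite /killing /axis1 /axis2 !vec3E !mxE; ring.
Qed.

Lemma killing_axis2_d1_e3 : killing axis2 (d1 (cochain2 0 e3)) = 0.
Proof.
rewrite killing_axis2_d1.
have -> : row 0 (cochain2 0 e3) = 0 by apply/rowP => j; rewrite !mxE.
have -> : row 1 (cochain2 0 e3) = e3 by apply/rowP => j; rewrite !mxE.
by rewrite /killing /axis1 /axis2 !vec3E !mxE; ring.
Qed.

Let n8 : (8%:R : K) != 0. Proof. by rewrite pnatr_eq0. Qed.

Lemma w00_neq0 : rho_word rho w 0 0 != 0.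
Proof.
apply/eqP => W0; have W1 := det_rho_word detr w.
have : delta * rho_word rho w 0 1 = 0.
  by apply: oppr_inj; rewrite oppr0 -phi_w /phi W0 sub0r.
move/eqP; rewrite mulf_eq0 (negPf (delta_neq0 m0 m1)) /= => /eqP W01.
by move: W1 (oner_neq0 K); rewrite det22 W0 W01 !mul0r subrr => <-; rewrite eqxx.
Qed.

Lemma d1_e3_neq0 : d1 (cochain2 0 e3) 0 0 != 0.
Proof. by rewrite d1_e3_entry oppr_eq0 !mulf_neq0 ?expf_neq0 // w00_neq0. Qed.

(** By [wact_filling] the quotient of the images of [h0] and [h] centralizes the
image of [d1].  The coboundaries of [e_2] and [e_3] on the second generator span
a plane there, so that the quotient is a scalar. *)
Lemma wact_winv_filling y : wact act (winv h) y = wact act (winv h0) y.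
Proof.
have uH := unit_rho_word detr h; have uH0 := unit_rho_word detr h0.
pose C := (rho_word rho h0)^-1 * rho_word rho h.
have uC : C \is a GRing.unit by rewrite unitrMl ?unitrV.
have comm x : C * sl2_mx (d1 x) = sl2_mx (d1 x) * C.
  have := congr1 (@sl2_mx K) (wact_filling x).
  rewrite !(sl2_wact detr) -(delta1E actl) -/d1.
  move=> /(congr1 (fun X => (rho_word rho h0)^-1 * X * rho_word rho h)).
  by rewrite !mulrA mulrVK // mulVr // mul1r -!mulrA.
have CE := centralizer_scalar (comm (cochain2 0 e3)) (comm (cochain2 0 e2))
  d1_e3_neq0 killing_axis2_d1_e3 _.
have {}CE : C = (C 0 0)%:M.
  by apply: CE; rewrite killing_axis2_d1_e2 oppr_eq0 mulf_neq0 // delta_neq0.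
apply: sl2_mx_inj; rewrite !(sl2_wact detr) !rho_word_winv // !invrK.
apply: (mulrI uC); transitivity ((rho_word rho h0)^-1 * sl2_mx y * rho_word rho h).
  by rewrite /C !mulrA mulrK.
have -> : rho_word rho h = rho_word rho h0 * C by rewrite /C mulVKr.
rewrite mulrA CE.
by rewrite -[LHS]/(_ *m _) -[RHS]/(_ *m _) scalar_mxC.
Qed.

(** The factor by which the conjugation by the image of [g_2] multiplies the upper
right entry; it occurs when [h0] is [g_1 v^-1 g_2^-1]. *)
Definition boundary_shift : K := if kappa == 1 then 1 else m ^+ 2.

Lemma boundary_shift_neq0 : boundary_shift != 0.
Proof. by rewrite /boundary_shift; case: ifP; rewrite ?oner_neq0 ?expf_neq0. Qed.

Lemma conjugator_axis_entry : wact act (winv h0) axis1 0 0 =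
  2%:R * (rho_word rho v 0 0 * phi v m u) * boundary_shift.
Proof.
rewrite /symmetry_conjugator /boundary_shift; case: ifP => _; rewrite winvK.
  by rewrite axis1_conj_entry // mulr1.
rewrite -cat1s !wact_cat /=.
have -> : act (linv g1) axis1 = axis1.
  by have := actK (linv g1) axis1; rewrite linvK Ad_axis1.
rewrite -axis1_conj_entry //; set S := wact act v axis1.
have -> : S = vec3 (S 0 0) (S 0 1) (S 0 2%:R) by apply: row3P; rewrite vec3E.
by rewrite Ad_g2E // !vec3E mulrC.
Qed.

Section Torsion.
Variables (P : 'rV[K]_3) (h1 : 'M[K]_(2, 3)) (h2 : 'M[K]_(1, 3)).
Variable b : graded_seq K 3.
Local Notation hC := (GradedSeq [::] [:: h1] [:: h2]).
Hypothesis P_peripheral : forall g, peripheral p q g -> wact act g P = P.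
Hypothesis hh : cohomology_basis act r hC.
Hypothesis hb : coboundary_lift act r b.
Hypothesis phi1h : killing P (on_path act h1 mu) = 1.

Let phi1 (x : 'M[K]_(2, 3)) := killing P (on_path act x mu).
Let psi1 (y : 'rV[K]_3) := killing axis2 y.
Let psi2 (y : 'rV[K]_3) := y 0 0.
Let phi2 (y : 'rV[K]_3) := killing P (on_chain2 act y (torus_chain p q h)).

Hypothesis phi2h : phi2 h2 != 0.

Let c : K := P 0 0 / 2%:R.

Let PE : P = c *: axis1.
Proof. apply: Ad_g1_invariant => //; exact: (P_peripheral (peripheral_mu p q)). Qed.

Let killingP x y : killing (x *: axis1) y = x * killing axis1 y.
Proof. by rewrite /killing !mxE; ring. Qed.

Lemma on_chain2E y : on_chain2 act y (torus_chain p q h) =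
  wact act (rev w) y - wact act h y.
Proof.
by rewrite /on_chain2 /torus_chain !big_cons big_nil /= mulr1z mulrN1z addr0.
Qed.

(** The two annuli of the torus are translates of the 2-cell by [rev w] and
[h], so the invariant vector is moved back by these words. *)
Let P' := c *: axis2 - wact act (winv h) P.

Lemma phi2E y : phi2 y = killing P' y.
Proof.
rewrite /phi2 on_chain2E killingBr !(killing_wactl detr) -killingBl; congr killing.
rewrite /P'; congr (_ - _).
have -> : P = wact act (rev w) (c *: axis2).
  by rewrite PE -wact_rev_tb_word_axis (wactZ actl).
by rewrite wactKV.
Qed.

Lemma P'_entry : P' 0 0 =
  - (2%:R * c * (rho_word rho v 0 0 * phi v m u) * boundary_shift).
Proof.
rewrite /P' wact_winv_filling PE (wactZ actl).
have -> : (c *: axis2 - c *: wact act (winv h0) axis1) 0 0 =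
   c * axis2 0 0 - c * wact act (winv h0) axis1 0 0 by rewrite !mxE.
by rewrite conjugator_axis_entry /axis2 vec3E; ring.
Qed.

(** The two copies of the 2-cell form a closed surface once the sides of the
square are glued, and the invariance of [P] glues them. *)
Lemma phi2_d1 x : phi2 (d1 x) = 0.
Proof.
rewrite /phi2 on_chain2E /d1 delta1E // wact_filling -on_path_torus_square.
rewrite on_path_wcomm // !killingBr killingDr.
have inv g y : peripheral p q g -> killing P (wact act g y) = killing P y.
  by move=> gp; apply: killing_wact_id => //; exact: P_peripheral.
have lp := peripheral_lambda p q; have mp := peripheral_mu p q.
have lV := peripheral_inv lp; have mV := peripheral_inv mp.
rewrite !inv //; first by ring.
  by rewrite /wcomm; do ![apply: peripheral_cat => //].
by do ![apply: peripheral_cat => //].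
Qed.

(** The coboundary of [e_3] is orthogonal to [axis2] and to [P'] and has a
nonzero upper right entry.  If that of [P'] were zero, as that of [axis2] is,
[P'] would be a multiple of [axis2];
but it is orthogonal to the coboundary of [e_2] and [axis2] is not, so [P'] would
be zero. *)
Lemma P'_entry_neq0 : P' 0 0 != 0.
Proof.
apply/eqP => P0; case/eqP: phi2h.
have dn := delta_neq0 m0 m1.
have Q0 := phi2_d1 (cochain2 0 e3); have Y0 := phi2_d1 (cochain2 0 e2).
have Q2 := killing_axis2_d1_e3; have Y2 := killing_axis2_d1_e2.
have Qn := d1_e3_neq0.
rewrite phi2E in Q0; rewrite phi2E in Y0; rewrite phi2E.
move: (d1 _) (d1 _) Q0 Y0 Q2 Y2 Qn => Y Q Q0 Y0 Q2 Y2 Qn.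
have n4 : (4%:R : K) != 0 by rewrite pnatr_eq0.
have axisE z : killing axis2 z = 8%:R * (delta * z 0 1) - 8%:R * (u * z 0 0).
  by rewrite /killing /axis2 !vec3E; ring.
rewrite !axisE in Q2 Y2.
have P'kE z : killing P' z = 8%:R * (P' 0 1 * z 0 1) + 4%:R * (P' 0 2%:R * z 0 0).
  by rewrite /killing P0; ring.
rewrite !P'kE in Q0 Y0 *.
move: (m - m^-1) dn Q2 Y2 {axisE} => dl dn Q2 Y2.
have Q1E : Q 0 1 = u / dl * Q 0 0.
  apply: (mulfI (mulf_neq0 n8 dn)).
  transitivity (8%:R * (dl * Q 0 1) - 8%:R * (u * Q 0 0) + 8%:R * (u * Q 0 0)).
    by ring.
  by rewrite Q2; field.
have P'E : P' 0 2%:R = - (2%:R * u / dl * P' 0 1).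
  apply: (mulIf Qn); apply: (mulfI n4).
  transitivity (8%:R * (P' 0 1 * Q 0 1) + 4%:R * (P' 0 2%:R * Q 0 0)
                - 8%:R * (P' 0 1 * Q 0 1)); first by ring.
  by rewrite Q0 Q1E; field.
have kE (z : 'rV[K]_3) : 8%:R * (P' 0 1 * z 0 1) + 4%:R * (P' 0 2%:R * z 0 0) =
    P' 0 1 / dl * (8%:R * (dl * z 0 1) - 8%:R * (u * z 0 0)).
  by rewrite P'E; field.
have P'1 : P' 0 1 = 0.
  move: Y0; rewrite kE Y2 => /eqP; rewrite !mulf_eq0 invr_eq0 oppr_eq0 mulf_eq0.
  by rewrite (negPf dn) (negPf n8) !orbF => /eqP.
by rewrite kE P'1 !mul0r.
Qed.

Lemma v00_phi_neq0 : rho_word rho v 0 0 * phi v m u != 0.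
Proof.
apply: contraNneq P'_entry_neq0 => v0.
by rewrite P'_entry v0 mulr0 mul0r oppr0.
Qed.

(** The functional [coord1] sees the coboundaries of degree zero with determinant
[2 (m^2 - 1)^2 / m]; the one on degree two has determinant
[- 32 delta P'_12], and the value of [P'_12] gives the factor [v_11 phi_v]. *)
Lemma riley_torsion :
  torsion act r b hC *
    (2%:R * (m ^+ 2 - 1) * (rho_word rho v 0 0 * phi v m u) * boundary_shift) =
  basis_det (unit_cochains1 K) * m ^+ 2 * rho_word rho w 0 0 * dphi * phi2 h2.
Proof.
have phi1_lin : scalar phi1.
  by move=> a x y; rewrite /phi1 on_path_linear // /killing !mxE; ring.
have psi1_lin : scalar psi1.
  by move=> a x y; rewrite /psi1 /killing !mxE; ring.
have psi2_lin : scalar psi2.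
  by move=> a x y; rewrite /psi2 !mxE.
have phi2_lin : scalar phi2.
  by move=> a x y; rewrite !phi2E /killing !mxE; ring.
have phi1E x : phi1 x = c * killing axis1 (row 0 x).
  rewrite /phi1 (on_path_letter actl) /= PE killingP //.
have phi1_d0 x : phi1 (d0 x) = 0.
  rewrite phi1E /d0 row_delta0 // killingBr.
  rewrite (@killing_wact_id _ rho [:: g1] axis1) ?subrr ?mulr0 //.
  exact: Ad_axis1.
have := torsion_functionals hh hb phi1_lin psi1_lin psi2_lin phi2_lin
  d10 phi1_d0 phi2_d1 phi1h.
rewrite -/d0 -/d1.
have row0 x y : row 0 (cochain2 x y) = x :> 'rV[K]_3 by apply/rowP => j; rewrite !mxE.
have -> : phi1 (cochain2 0 e2) = 0 by rewrite phi1E row0 /killing !mxE; ring.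
have -> : phi1 (cochain2 0 e3) = 0 by rewrite phi1E row0 /killing !mxE; ring.
have -> : phi1 (cochain2 e2 0) = 8%:R * c * delta.
  by rewrite phi1E row0 /killing /axis1 !vec3E; ring.
rewrite /psi1 killing_axis2_d1_e3 killing_axis2_d1_e2 /psi2 d1_e3_entry.
rewrite -/psi1 -/psi2.
have d0E x i j : d0 x i j = act (i, true) x 0 j - x 0 j.
  transitivity (row i (d0 x) 0 j); first by rewrite mxE.
  by rewrite /d0 row_delta0 // mxE [X in _ + X]mxE.
have -> : \det (\matrix_(i < 3) coord1 (d0 (nth 0 (unit_cochains0 K) i))) =
    2%:R * (m ^+ 2 - 1) ^+ 2 / m.
  rewrite [LHS](det33_functionals (fun x => d0 x 0 0) (fun x => d0 x 0 2%:R)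
    (fun x => d0 x 1 0)) !d0E.
  rewrite (Ad_g1E u m0 1 0 0) (Ad_g1E u m0 0 1 0) (Ad_g1E u m0 0 0 1).
  rewrite (Ad_g2E u m0 1 0 0) (Ad_g2E u m0 0 1 0) (Ad_g2E u m0 0 0 1).
  by rewrite !vec3E; field.
have -> : \det (\matrix_(i < 3) chi2 psi1 psi2 phi2 (nth 0 (unit_cochains0 K) i)) =
    - (32%:R * delta * P' 0 0).
  rewrite [LHS](det33_functionals psi1 psi2 phi2) !phi2E /psi1 /psi2.
  by move: P' => Q; rewrite /killing /axis2 !vec3E; ring.
have dn := delta_neq0 m0 m1.
have n2 : (2%:R : K) != 0 by rewrite pnatr_eq0.
have n32 : (32%:R : K) != 0 by rewrite pnatr_eq0.
have m21 : m ^+ 2 - 1 != 0 by rewrite subr_eq0.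
have P'n := P'_entry_neq0.
move=> /(_ erefl erefl erefl) tE; have {tE} := tE _ _.
rewrite oppr_eq0 !mulf_neq0 ?invr_neq0 ?expf_neq0 // => /(_ erefl erefl).
have c0 : c != 0.
  by apply: contraNneq P'n => c0; rewrite P'_entry c0 mulr0 !mul0r oppr0.
rewrite P'_entry; move: (torsion _ _ _ _) (basis_det _) => t s tE.
(* This is the factor common to both sides of [tE] and left out of the
   conclusion: [64 = 2 * 32], with [c] from [P] and [delta = (m^2 - 1) / m]. *)
have n64 : 64%:R * (c * delta ^+ 2) != 0
  by apply: mulf_neq0; [rewrite pnatr_eq0 | rewrite mulf_neq0 ?expf_neq0].
apply: (mulIf n64).
transitivity (t * (2%:R * (m ^+ 2 - 1) ^+ 2 / m * - (32%:R * delta *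
  - (2%:R * c * (rho_word rho v 0 0 * phi v m u) * boundary_shift)))).
  by field.
by rewrite tE; ring.
Qed.

End Torsion.

End TwoBridgeTorsion.

(** * The formula *)

Theorem theorem1p1 (R : realType) (p : nat) (q : int) (k : nat)
    (h : word) (o : bool) (hR : graded_seq R 1) :
  (0 < p)%N -> odd p -> odd `|q|%N -> coprime p `|q|%N ->
  - p%:Z < q -> q < p%:Z ->
  (0 < k < p)%N ->
  (k%:Z * q = 1 %[mod p.*2%:Z])%Z \/ (k%:Z * q = -1 %[mod p.*2%:Z])%Z ->
  torus_filling p q h ->
  cohomology_basis (@trivial_act R) (relator p q) hR ->
  exists s : bool, forall m u : R[i],
    m != 0 -> u != 0 -> phi (tb_word p q) m u = 0 ->
    rho_word (riley m u) (relator p q) = 1 ->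
    irreducible_rep (riley m u) ->
    mu_regular p q (riley m u) ->
    m != 1 -> m != -1 ->
    dphi_dm (tb_word p q) m u != 0 ->
    dphi_du (tb_word p q) m u != 0 ->
    forall T : R[i], is_adjoint_torsion p q h o hR (riley m u) T ->
    T = (-1) ^+ s
        * (m ^ (eps p q k + 1) / (2%:R * (m ^+ 2 - 1)))
        * (rho_word (riley m u) (tb_word p q) 0 0
           / (rho_word (riley m u) (tb_prefix p q k.-1) 0 0
              * phi (tb_prefix p q k.-1) m u))
        * dphi_du (tb_word p q) m u.
Proof.
move=> p0 p_odd q_odd pq _ _ kp kq filling hRbasis.
have [kappa [kappa1 {}kq]] : exists kappa : int,
    (kappa = 1 \/ kappa = -1) /\ (k%:Z * q = kappa %[mod p.*2%:Z])%Z.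
  by case: kq => kq; [exists 1 | exists (-1)]; split=> //; [left | right].
have [sR sRE] := trivial_torsion_sign hRbasis.
have [s1 s1E] := basis_det_unit_cochains1 R[i].
(* The negation is the sign of Turaev's exponent, which is odd. *)
exists (~~ (sR (+) s1 (+) o)) => m u m0 u0 phi_w rho_r _ _ mn1 mnN1 _ dphi T.
case=> P [h1 [h2 [b [bR]]]] /= [[Pn0 Pinv] hh [phi1h phi2h] [hb hbR] ->].
have m1 : m ^+ 2 != 1 by rewrite sqrf_eq1 negb_or mn1.
have phi2E : killing P (on_chain2 (Ad (riley m u)) h2 (torus_chain p q h)) = (-1) ^+ o.
  by rewrite -[LHS](signrMK o) phi2h mulr1.
have phi2n : killing P (on_chain2 (Ad (riley m u)) h2 (torus_chain p q h)) != 0.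
  by rewrite phi2E signr_eq0.
have tE := riley_torsion p0 p_odd q_odd pq kp kappa1 kq m0 m1 phi_w rho_r
  dphi filling Pinv hh hb phi1h phi2n.
have vn := v00_phi_neq0 p0 p_odd q_odd pq kp kappa1 kq m0 m1 phi_w rho_r
  dphi filling Pinv phi2n.
rewrite sRE // (turaev_exponentE hh) (eps_k kp kappa1 kq).
rewrite phi2E s1E in tE; move: (torsion _ _ _ _) tE => t tE.
have m21 : m ^+ 2 - 1 != 0 by rewrite subr_eq0.
have n2 : (2%:R : R[i]) != 0 by rewrite pnatr_eq0.
have sn := boundary_shift_neq0 kappa m0.
have expE : m ^ (kappa + 1) = m ^+ 2 / boundary_shift kappa m.
  rewrite /boundary_shift; case: kappa1 => -> /=; last by rewrite expr0z mulfV ?expf_neq0.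
  by rewrite divr1.
rewrite expE.
have tn := mulf_neq0 (mulf_neq0 (mulf_neq0 n2 m21) vn) sn.
apply: (mulIf tn); rewrite -[LHS]mulrA tE rmorph_sign.
rewrite -signr_odd signrN !signr_addb.
move: (boundary_shift _ _) sn {tn tE expE} => e sn.
move: (rho_word _ (tb_prefix _ _ _)) (phi (tb_prefix _ _ _) _ _) vn => V f.
rewrite mulf_eq0 negb_or => /andP[V0 f0].
by rewrite /=; field; rewrite f0 V0 m21 sn.
Qed.
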